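(* Let $N\ge 1$ be an integer, $1<p<\infty$ and $N<q\le\infty$. There exists a constant $C=C(N,p,q)$ such that $$\iint_{B_1\times B_1}\frac{|u(x)-u(y)|^p}{|x-y|^{N+1}}\,dx\,dy\le C\,\|u\|_{L^\infty(B_1)}^{p-1}\,\|\nabla u\|_{L^1(B_1)}\left(1+\log\max\left\{\frac{\|\nabla u\|_{L^q(B_1)}}{\|u\|_{L^\infty(B_1)}},1\right\}\right)$$ for every $u\in C^1(\overline{B_1})$.
   Context: $B_1$ denotes the unit ball in $\mathbb{R}^N$ and functions are real-valued. For $u\equiv 0$ the right-hand side is interpreted as $0$. *)

(* Defs.v *)
From HB Require Import structures.
From mathcomp Require Import all_boot all_order all_algebra.
From mathcomp Require Import all_classical all_reals all_analysis.

Set Implicit Arguments.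
Unset Strict Implicit.
Unset Printing Implicit Defensive.

Import Order.TTheory GRing.Theory Num.Theory.
Import numFieldNormedType.Exports.

Local Open Scope classical_set_scope.
Local Open Scope ring_scope.

Definition measure_rV_display : measure_display -> measure_display.
Proof. exact. Qed.

(* 'rV[T]_n carries the product sigma-algebra, i.e. the one generated by the
   coordinates, exactly as n.-tuple T does in the library. *)
Section measurable_rV.
Context {d} {T : measurableType d}.
Variable n : nat.

Let coors : 'I_n -> 'rV[T]_n -> T := fun i x => x ord0 i.

Let rV_set0 : g_sigma_preimage coors set0.
Proof. exact: sigma_algebra0. Qed.

Let rV_setC A : g_sigma_preimage coors A -> g_sigma_preimage coors (~` A).
Proof. exact: sigma_algebraC. Qed.

Let rV_bigcup (F : _^nat) : (forall i, g_sigma_preimage coors (F i)) ->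
  g_sigma_preimage coors (\bigcup_i (F i)).
Proof. exact: sigma_algebra_bigcup. Qed.

HB.instance Definition _ := @isMeasurable.Build (measure_rV_display d)
  'rV[T]_n (g_sigma_preimage coors) rV_set0 rV_setC rV_bigcup.

End measurable_rV.

Lemma measurable_rV_coord d (T : measurableType d) n (i : 'I_n) :
  measurable_fun [set: 'rV[T]_n] (fun x : 'rV[T]_n => x ord0 i).
Proof.
move=> _ Y mY; rewrite setTI; apply: sub_sigma_algebra => /=.
rewrite -bigcup_seq/=; exists i => /=; first by rewrite mem_index_enum.
by exists Y => //; rewrite setTI.
Qed.

Lemma measurable_fun_rVP d1 d2 (T1 : measurableType d1) (T2 : measurableType d2)
    n (f : T1 -> 'rV[T2]_n) :
  (forall i, measurable_fun [set: T1] (fun x => f x ord0 i)) ->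
  measurable_fun [set: T1] f.
Proof.
move=> mf _ A mA; rewrite setTI.
suff : preimage_set_system setT f (@measurable _ 'rV[T2]_n) `<=` measurable.
  by apply; exists A => //; rewrite setTI.
rewrite -[X in X `<=` _]g_sigma_preimage_comp.
apply: smallest_sub; first exact: sigma_algebra_measurable.
move=> {mA}A; rewrite -bigcup_seq => -[i _] [B mB <-].
exact: mf.
Qed.

Section lebesgue_rV.
Context {R : realType}.

Definition consrV n (z : measurableTypeR R * 'rV[R]_n) : 'rV[R]_n.+1 :=
  \row_i if unlift ord0 i is Some j then z.2 ord0 j else z.1.

Lemma measurable_consrV n : measurable_fun setT (@consrV n).
Proof.
apply: measurable_fun_rVP => i; rewrite /consrV.
case: (unliftP ord0 i) => [j ->|->].
- apply: (eq_measurable_fun (fun z : _ * 'rV[R]_n => z.2 ord0 j)).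
    by move=> z _; rewrite mxE liftK.
  exact: (measurableT_comp (measurable_rV_coord j)).
- apply: (eq_measurable_fun (fun z : measurableTypeR R * 'rV[R]_n => z.1 : R)).
    by move=> z _; rewrite mxE unlift_none.
  exact: measurable_fst.
Qed.

Section step.
Variables (n : nat) (m : {sigma_finite_measure set 'rV[R]_n -> \bar R}).

Definition lebesgue_rV_step : set 'rV[R]_n.+1 -> \bar R :=
  pushforward (@lebesgue_measure R \x m)%E (@consrV n).

Let mcons : measurable_fun setT (@consrV n) := @measurable_consrV n.

Let step0 : lebesgue_rV_step set0 = 0%E.
Proof. exact: measure0. Qed.

Let step_ge0 A : (0 <= lebesgue_rV_step A)%E.
Proof. exact: measure_ge0. Qed.

Let step_sigma_additive : semi_sigma_additive lebesgue_rV_step.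
Proof. exact: measure_semi_sigma_additive. Qed.

HB.instance Definition _ := isMeasure.Build _ _ _ lebesgue_rV_step
  step0 step_ge0 step_sigma_additive.

Let step_sigma_finite : sigma_finite setT lebesgue_rV_step.
Proof.
pose splitrV (x : 'rV[R]_n.+1) : measurableTypeR R * 'rV[R]_n :=
  (x ord0 ord0, \row_j x ord0 (lift ord0 j)).
have splitrVK : cancel (@consrV n) splitrV.
  move=> [a v]; rewrite /splitrV /consrV mxE unlift_none; congr pair.
  by apply/rowP => j; rewrite !mxE liftK.
have msplit : measurable_fun setT splitrV.
  apply/measurable_fun_pairP; split; first exact: measurable_rV_coord.
  apply: measurable_fun_rVP => j.
  apply: (eq_measurable_fun (fun x : 'rV[R]_n.+1 => x ord0 (lift ord0 j))).
    by move=> x _; rewrite /= mxE.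
  exact: measurable_rV_coord.
have /sigma_finiteP[F [TF ndF Foo]] := sigma_finiteT (@lebesgue_measure R).
have /sigma_finiteP[G [TG ndG Goo]] := sigma_finiteT m.
exists (fun k => splitrV @^-1` (F k `*` G k)).
  rewrite -preimage_bigcup; apply/esym; rewrite -subTset => x _ /=.
  have [i _ Fi] : (\bigcup_k F k) (splitrV x).1 by rewrite -TF.
  have [j _ Gj] : (\bigcup_k G k) (splitrV x).2 by rewrite -TG.
  exists (maxn i j) => //; split.
  - by move: Fi; exact/subsetPset/ndF/leq_maxl.
  - by move: Gj; exact/subsetPset/ndG/leq_maxr.
move=> k; have [mF Fk] := Foo k; have [mG Gk] := Goo k; split.
  by rewrite -[X in measurable X]setTI; apply: msplit => //; exact: measurableX.
rewrite /lebesgue_rV_step /pushforward -comp_preimage.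
rewrite (_ : splitrV \o _ = id); last by rewrite funeqE => z /=; rewrite splitrVK.
by rewrite preimage_id product_measure1E// lte_mul_pinfty// ge0_fin_numE.
Qed.

HB.instance Definition _ := Measure_isSigmaFinite.Build _ _ _
  lebesgue_rV_step step_sigma_finite.

End step.

(* N-dimensional Lebesgue measure, as the N-fold product of the
   one-dimensional one; on 'rV_0 it is the Dirac mass at the only point. *)
Fixpoint lebesgue_rV n : {sigma_finite_measure set 'rV[R]_n -> \bar R} :=
  if n is k.+1 then lebesgue_rV_step (lebesgue_rV k) else \d_(0 : 'rV[R]_0).

End lebesgue_rV.
Arguments lebesgue_rV {R} n.

Lemma lebesgue_rV_box {R : realType} n (A : 'I_n -> set (measurableTypeR R)) :
  (forall i, measurable (A i)) ->
  lebesgue_rV n [set x : 'rV[R]_n | forall i, A i (x ord0 i)] =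
  \big[mule/1%E]_(i < n) lebesgue_measure (A i).
Proof.
elim: n A => [|n IH] A mA.
  rewrite big_ord0 /= /dirac indicE mem_set //=; by case.
rewrite big_ord_recl -IH; last by move=> i; exact: mA.
have mB : measurable [set x : 'rV[R]_n | forall i, A (lift ord0 i) (x ord0 i)].
  have -> : [set x : 'rV[R]_n | forall i, A (lift ord0 i) (x ord0 i)] =
    \bigcap_(i in [set: 'I_n])
      ((fun x : 'rV[R]_n => x ord0 i) @^-1` A (lift ord0 i)).
    by apply/seteqP; split => x /= h; [move=> i _|move=> i]; exact: h.
  apply: fin_bigcap_measurable => // i _.
  rewrite -[X in measurable X]setTI; apply: measurable_rV_coord => //; exact: mA.
transitivity ((@lebesgue_measure R \x lebesgue_rV n)%E
  (A ord0 `*` [set x : 'rV[R]_n | forall i, A (lift ord0 i) (x ord0 i)]));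
  last by rewrite product_measure1E.
rewrite /= /lebesgue_rV_step /pushforward; congr (_ _).
apply/seteqP; split => -[a v] /=.
  move=> h; split; first by have := h ord0; rewrite mxE unlift_none.
  by move=> i; have := h (lift ord0 i); rewrite mxE liftK.
by move=> [h1 h2] i; rewrite mxE; case: unliftP => [j ->|->].
Qed.

Section euclidean.
Context {R : realType} {N : nat}.
Implicit Types x : 'rV[R]_N.

(* The library norm `|x| on 'rV_N is the sup norm, hence this definition. *)
Definition enorm x : R := Num.sqrt (\sum_i x ord0 i ^+ 2).

Definition unit_ball : set 'rV[R]_N := [set x | enorm x < 1].

Definition closed_unit_ball : set 'rV[R]_N := [set x | enorm x <= 1].

Definition grad (u : 'rV[R]_N -> R) x : 'rV[R]_N :=
  \row_i 'D_(delta_mx ord0 i) u x.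

(* u is in C^1 of the closed ball: u is C^1 inside, and u and its gradient
   extend continuously up to the boundary. The values of u outside the closed
   ball are irrelevant. *)
Definition C1_closed_unit_ball (u : 'rV[R]_N -> R) :=
  [/\ {within closed_unit_ball, continuous u},
      forall x, unit_ball x -> differentiable u x &
      exists2 G : 'rV[R]_N -> 'rV[R]_N,
        {within closed_unit_ball, continuous G} &
        forall x, unit_ball x -> G x = grad u x].

(* The L^r norm over the unit ball, 1 <= r <= +oo; f \_ D is f extended by 0
   outside D. *)
Definition LnormB (r : \bar R) (f : 'rV[R]_N -> R) : \bar R :=
  ('N[lebesgue_rV N]_r [EFin \o (f \_ unit_ball)])%E.

End euclidean.

(* Main.v *)
(* Split the double integral over the dyadic shells |x - y| ~ r = 2^-k.  On each
   shell |u x - u y|^p is at most m^(p-1) |u x - u y|, where m bounds the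
   oscillation of u at scale r, and the integral of |u x - u y| over
   |x - y| < r is at most C r^(N+1) ||grad u||_1, which exactly compensates the
   kernel |x - y|^-(N+1): every shell contributes C m^(p-1) ||grad u||_1.
   For large r take m = 2 ||u||_oo.  For small r use Morrey's inequality
   m <= C ||grad u||_q r^(1 - N/q), whose (p-1)-st powers form a convergent
   geometric series.  The number of shells before Morrey's bound falls below
   ||u||_oo is comparable to 1 + log (||grad u||_q / ||u||_oo). *)

Require Import Defs.
From HB Require Import structures.
From mathcomp Require Import all_boot all_order all_algebra.
From mathcomp Require Import all_classical all_reals all_analysis.
From mathcomp Require Import measurable_realfun ess_sup_inf.
From mathcomp Require Import ring lra.

Set Implicit Arguments.
Unset Strict Implicit.
Unset Printing Implicit Defensive.

Import Order.TTheory GRing.Theory Num.Theory.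
Import numFieldNormedType.Exports.

Local Open Scope classical_set_scope.
Local Open Scope ring_scope.

(** * The Euclidean norm and Lebesgue measure on row vectors *)

Section enorm_theory.
Context {R : realType} {N : nat}.
Implicit Types x y : 'rV[R]_N.

(** Both gradient estimates write a difference of values of [u] as an integral along a segment,
    which stays in the ball by convexity, and let Tonelli exchange the parameter t with the points.
    Near the diagonal, for fixed t and fixed displacement h = y - x, the map x -> x + t h is a
    translation, so only the L^1 norm of the gradient remains; one factor r is the length of the
    segment and r^N is the volume of the displacements. In Morrey's inequality one endpoint is fixed
    and the other is averaged over a small ball, so for fixed t the map is a dilation whose ratio
    tends to 0 with t; this singularity is what has to be tamed, and q > N is what makes it
    integrable. The constant may depend on N, p and q only. The ratio D = max(||grad u||_q /
    ||u||_oo, 1) is therefore allowed to act solely through the number n of shells that use the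
    trivial bound: n is chosen so that the decay over these shells absorbs D, and the remaining tail
    is bounded independently of [u]. *)

Lemma sum_sqr_ge0 x : 0 <= \sum_i x ord0 i ^+ 2.
Proof. by apply: sumr_ge0 => i _; exact: sqr_ge0. Qed.

Lemma sqr_enorm x : enorm x ^+ 2 = \sum_i x ord0 i ^+ 2.
Proof. by rewrite sqr_sqrtr// sum_sqr_ge0. Qed.

Lemma enorm_ge0 x : 0 <= enorm x.
Proof. exact: sqrtr_ge0. Qed.

Lemma enormZ (c : R) x : enorm (c *: x) = `|c| * enorm x.
Proof.
rewrite /enorm -sqrtr_sqr -sqrtrM ?sqr_ge0// mulr_sumr.
by congr Num.sqrt; apply: eq_bigr => i _; rewrite mxE exprMn.
Qed.

Lemma enorm_distC x y : enorm (x - y) = enorm (y - x).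
Proof. by rewrite -opprB -scaleN1r enormZ normrN1 mul1r. Qed.

Lemma le_coord_enorm x i : `|x ord0 i| <= enorm x.
Proof.
rewrite -sqrtr_sqr ler_wsqrtr// (bigD1 i)//= lerDl.
by apply: sumr_ge0 => j _; exact: sqr_ge0.
Qed.

Lemma enorm0 : enorm (0 : 'rV[R]_N) = 0.
Proof. by rewrite -(scale0r 0) enormZ normr0 mul0r. Qed.

Lemma enorm_gt0 x : x != 0 -> 0 < enorm x.
Proof.
move=> x0; rewrite lt_neqAle enorm_ge0 andbT; apply: contra x0 => /eqP xn.
apply/eqP/rowP => i; rewrite mxE; apply/eqP.
by rewrite -normr_le0 xn le_coord_enorm.
Qed.

(** Stands in for the triangle inequality: for two vectors of norm at most r it gives the same bound
    2r on the sum. *)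
Lemma sqr_enormD_le x y : enorm (x + y) ^+ 2 <= 2 * (enorm x ^+ 2 + enorm y ^+ 2).
Proof.
rewrite !sqr_enorm -big_split/= mulr_sumr; apply: ler_sum => i _.
by rewrite mxE; have := sqr_ge0 (x ord0 i - y ord0 i); nra.
Qed.

Lemma unit_ball_sqr x : unit_ball x <-> \sum_i x ord0 i ^+ 2 < 1.
Proof.
rewrite /unit_ball/= -sqr_enorm; split => h.
  by rewrite expr_lt1// enorm_ge0.
by rewrite -(@expr_lt1 _ 2) ?enorm_ge0.
Qed.

Lemma unit_ball_convex x y (t : R) : 0 <= t <= 1 ->
  unit_ball x -> unit_ball y -> unit_ball (x + t *: (y - x)).
Proof.
move=> /andP[t0 t1] /unit_ball_sqr bx /unit_ball_sqr bY; apply/unit_ball_sqr.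
apply: (@le_lt_trans _ _ ((1 - t) * (\sum_i x ord0 i ^+ 2)
    + t * (\sum_i y ord0 i ^+ 2))).
  rewrite !mulr_sumr -big_split/=; apply: ler_sum => i _; rewrite !mxE.
  have : 0 <= t * (1 - t) * (x ord0 i - y ord0 i) ^+ 2.
    by rewrite mulr_ge0 ?sqr_ge0// mulr_ge0// subr_ge0.
  by nra.
move: bx bY; move: (\sum_i _) (\sum_i _) => b a a1 b1.
have [ab|/ltW ab] := leP a b.
  apply: le_lt_trans b1; rewrite -subr_ge0.
  by rewrite (_ : _ - _ = (1 - t) * (b - a)) ?mulr_ge0 ?subr_ge0//; ring.
apply: le_lt_trans a1; rewrite -subr_ge0.
by rewrite (_ : _ - _ = t * (a - b)) ?mulr_ge0 ?subr_ge0//; ring.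
Qed.

Lemma unit_ball_dist x y : unit_ball x -> unit_ball y -> enorm (x - y) < 2.
Proof.
rewrite /unit_ball/= => bx bY.
rewrite -(@ltr_pXn2r _ 2) ?nnegrE ?enorm_ge0//.
apply: (le_lt_trans (sqr_enormD_le _ _)).
rewrite -(sub0r y) enorm_distC subr0.
have := enorm_ge0 x; have := enorm_ge0 y; nra.
Qed.

Lemma coord_cvg x i : (y ord0 i) @[y --> x] --> x ord0 i.
Proof. exact: (@coord_continuous R 1 N ord0 i x). Qed.

Lemma continuous_sqr_enorm : continuous (fun x => \sum_i x ord0 i ^+ 2).
Proof.
apply: continuous_big => [|i _ x]; first exact: add_continuous.
apply: (@continuous_comp _ _ _ (fun x : 'rV[R]_N => x ord0 i) (fun r : R => r ^+ 2)).
  exact: coord_cvg.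
exact: exprn_continuous.
Qed.

Lemma open_unit_ball : open (unit_ball : set 'rV[R]_N).
Proof.
have -> : unit_ball = (fun x : 'rV[R]_N => \sum_i x ord0 i ^+ 2) @^-1` [set r | r < 1].
  by apply/seteqP; split => x /unit_ball_sqr.
by apply: open_comp; [move=> x _; exact: continuous_sqr_enorm|exact: open_lt].
Qed.

Lemma unit_ball_sub_closed : unit_ball `<=` (closed_unit_ball : set 'rV[R]_N).
Proof. by move=> x; exact: ltW. Qed.

Lemma compact_closed_unit_ball : compact (closed_unit_ball : set 'rV[R]_N).
Proof.
apply: bounded_closed_compact.
  exists 1; split; first exact: real1.
  move=> M M1 x x1 /=; rewrite [leLHS](_ : _ = mx_norm x)// mx_normrE.
  apply: bigmax_le => /=.
    by apply: ltW; apply: lt_trans M1.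
  move=> [i j] _ /=; rewrite ord1.
  by apply: (le_trans (le_coord_enorm _ _)); apply: (le_trans x1); exact: ltW.
have -> : closed_unit_ball =
    (fun x : 'rV[R]_N => \sum_i x ord0 i ^+ 2) @^-1` [set r | r <= 1].
  apply/seteqP; split => x; rewrite /closed_unit_ball/= -sqr_enorm => h.
    by rewrite expr_le1// enorm_ge0.
  by rewrite -(@expr_le1 _ 2) ?enorm_ge0.
by apply: closed_comp; [move=> x _; exact: continuous_sqr_enorm|exact: closed_le].
Qed.

Lemma ball_rVE x (e : R) : 0 < e ->
  ball x e = [set y : 'rV[R]_N | forall i, ball (x ord0 i) e (y ord0 i)].
Proof.
move=> e0; apply/seteqP; split => y /=.
  by move=> [_ h] i; exact: h.
by move=> h; split => // i j; rewrite ord1; exact: h.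
Qed.

Lemma measurable_ball_rV x (e : R) : 0 < e -> measurable (ball x e).
Proof.
move=> e0; rewrite ball_rVE//.
have -> : [set y : 'rV[R]_N | forall i, ball (x ord0 i) e (y ord0 i)] =
    \bigcap_(i in [set: 'I_N])
      ((fun y : 'rV[R]_N => y ord0 i) @^-1` ball (x ord0 i) e).
  by apply/seteqP; split => y /= h; [move=> i _|move=> i]; exact: h.
apply: fin_bigcap_measurable => // i _.
rewrite -[X in measurable X]setTI; apply: measurable_rV_coord => //.
exact: measurable_ball.
Qed.

(** The sigma-algebra is generated by the coordinates, so topology has to be linked to it: an open
    set is the countable union of the sup-norm balls with rational centre and radius that it
    contains, and each of these is a box. *)
Lemma open_measurable_rV (O : set 'rV[R]_N) : open O -> measurable O.
Proof.
move=> oO.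
pose I := ('rV[rat]_N * rat)%type.
pose c (j : I) : 'rV[R]_N := map_mx ratr j.1.
pose P (j : I) := 0 < (ratr j.2 : R) /\ ball (c j) (ratr j.2 : R) `<=` O.
have -> : O = \bigcup_(j in [set: I])
    (if pselect (P j) then ball (c j) (ratr j.2 : R) else set0).
  apply/seteqP; split; last first.
    by move=> x [j _]; case: (pselect (P j)) => // -[_ jO] /jO.
  move=> x Ox.
  have /nbhs_ballP[e /= e0 eO] : nbhs x O by exact: open_nbhs_nbhs.
  have [r /andP[r0 re]] : exists r : rat, 0 < (ratr r : R) < e / 2.
    have /rat_in_itvoo[r] : 0 < e / 2 by rewrite divr_gt0.
    by rewrite in_itv/=; exists r.
  have H i : exists s : rat, `|x ord0 i - ratr s| < (ratr r : R).
    have /rat_in_itvoo[s] : x ord0 i - ratr r < x ord0 i + ratr r.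
      by rewrite ltrBlDr -addrA ltrDl addr_gt0.
    rewrite in_itv/= => /andP[s1 s2]; exists s; rewrite ltr_norml.
    by apply/andP; split; lra.
  pose s i := sval (cid (H i)).
  pose j : I := (\row_i s i, r).
  exists j => //.
  have Pj : P j.
    split => // y; rewrite ball_rVE// => yj; apply: eO.
    rewrite ball_rVE// => i; have := yj i; rewrite /ball/= /c /= !mxE => yi.
    have := svalP (cid (H i)); rewrite -/(s i) => xi.
    have := ler_normD (x ord0 i - ratr (s i)) (ratr (s i) - y ord0 i).
    by rewrite addrA subrK; lra.
  case: (pselect (P j)) => [? /=|//]; rewrite ball_rVE// => i.
  rewrite /ball/= /c /= !mxE distrC; exact: (svalP (cid (H i))).
apply: countable_bigcupT_measurable; first exact: countableP.
move=> j; case: (pselect (P j)) => [[j0 jO]|nP] //=; exact: measurable_ball_rV.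
Qed.

Lemma measurable_unit_ball : measurable (unit_ball : set 'rV[R]_N).
Proof. by apply: open_measurable_rV; exact: open_unit_ball. Qed.

Lemma measurable_fun_continuous_open (O : set 'rV[R]_N) (f : 'rV[R]_N -> R) :
  open O -> (forall x, O x -> {for x, continuous f}) -> measurable_fun O f.
Proof.
move=> oO cf; apply: (measurability _ (RGenOpens.measurableE R)).
move=> _ [_ [a [b ->] <-]]; apply: open_measurable_rV.
rewrite openE => x [Ox /= fx]; apply: (@filterI _ (nbhs x)); first exact: open_nbhs_nbhs.
by apply: (cf x Ox); apply: open_nbhs_nbhs; split => //; exact: interval_open.
Qed.

(** [ball] refers to the sup norm, so it is a product of intervals of length 2e. *)
Lemma lebesgue_rV_ball x (e : R) : 0 < e ->
  lebesgue_rV N (ball x e) = ((2 * e) ^+ N)%:E.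
Proof.
move=> e0; rewrite ball_rVE//.
rewrite (@lebesgue_rV_box R N (fun i => ball (x ord0 i) e)); last first.
  by move=> i; exact: measurable_ball.
rewrite (eq_bigr (fun=> (2 * e)%:E)).
  by rewrite prodEFin prodr_const card_ord.
by move=> i _; rewrite lebesgue_measure_ball ?ltW// mulr_natl.
Qed.

Lemma lebesgue_rV_open_gt0 (O : set 'rV[R]_N) x : open O -> O x ->
  (0 < lebesgue_rV N O)%E.
Proof.
move=> oO Ox; have /nbhs_ballP[e /= e0 eO] : nbhs x O by exact: open_nbhs_nbhs.
apply: (@lt_le_trans _ _ (lebesgue_rV N (ball x e))).
  by rewrite lebesgue_rV_ball// lte_fin exprn_gt0// mulr_gt0.
by apply: le_measure => //; rewrite inE;
  [exact: measurable_ball_rV|exact: open_measurable_rV].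
Qed.

Lemma measurable_enorm_lt (r : R) : measurable [set y : 'rV[R]_N | enorm y < r].
Proof.
have [r0|r0] := ltP 0 r; last first.
  rewrite (_ : [set y | _] = set0)//; apply/seteqP; split => // y /= yr.
  by have := lt_le_trans yr r0; rewrite ltNge enorm_ge0.
have -> : [set y : 'rV[R]_N | enorm y < r] =
    (fun x : 'rV[R]_N => \sum_i x ord0 i ^+ 2) @^-1` [set s | s < r ^+ 2].
  apply/seteqP; split => x /=; rewrite -sqr_enorm ltr_pXn2r ?nnegrE ?enorm_ge0//;
    exact: ltW.
apply: open_measurable_rV.
by apply: open_comp; [move=> x _; exact: continuous_sqr_enorm|exact: open_lt].
Qed.

Lemma lebesgue_rV_enorm_lt (r : R) : 0 < r ->
  (lebesgue_rV N [set y : 'rV[R]_N | (enorm y < r)%R] <= ((2 * r) ^+ N)%:E)%E.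
Proof.
move=> r0; rewrite -(@lebesgue_rV_ball 0)//.
apply: le_measure; rewrite ?inE; [exact: measurable_enorm_lt|exact: measurable_ball_rV|].
move=> y yr; rewrite ball_rVE// => i; rewrite /ball/= mxE sub0r normrN.
by apply: le_lt_trans yr; exact: le_coord_enorm.
Qed.

Lemma lebesgue_rV_unit_ball_lty : (lebesgue_rV N (@unit_ball R N) < +oo)%E.
Proof. by apply: le_lt_trans (lebesgue_rV_enorm_lt ltr01) _; rewrite ltry. Qed.

End enorm_theory.

(** * Translations and dilations of Lebesgue measure *)

Section affine_change_of_variables.
Context {R : realType}.
Local Notation mu := (@lebesgue_measure R).

(** The pushforward of Lebesgue measure under x -> c + l x, multiplied by l, gives half-open
    intervals their length, so uniqueness identifies it with Lebesgue measure. *)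
Lemma ge0_integral_affine (f : R -> \bar R) (c l : R) : 0 < l ->
  measurable_fun setT f -> (forall x, 0 <= f x)%E ->
  (\int[mu]_x f (c + l * x)%R = (l^-1)%:E * \int[mu]_x f x)%E.
Proof.
move=> l0 mf f0.
pose phi (x : measurableTypeR R) : measurableTypeR R := c + l * x.
have mphi : measurable_fun setT phi.
  by apply: measurable_funD => //; apply: measurable_funM.
have pE A : measurable A -> pushforward mu phi A = ((l^-1)%:E * mu A)%E.
  move=> mA.
  pose m : {measure set (measurableTypeR R) -> \bar R} :=
    mscale (NngNum (ltW l0)) (pushforward mu phi).
  have := @lebesgue_measure_unique R (m mphi) _ A mA.
  move=> ->; last first.
    move=> _ [[a b]] _ <- /=.
    rewrite /m /mscale/= /pushforward.
    have -> : phi @^-1` `]a, b] = `](a - c) / l, (b - c) / l]%classic.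
      apply/seteqP; split => x /=; rewrite !in_itv/= /phi;
      by rewrite ltr_pdivrMr// ler_pdivlMr// ltrBlDl lerBrDl mulrC.
    rewrite !lebesgue_measure_itv/= !lte_fin ltr_pM2r ?invr_gt0// ltrD2r.
    case: ifPn => _; last by rewrite mule0.
    rewrite -!EFinB -EFinM; congr (_%:E).
    by rewrite -mulrBl mulrC mulfVK ?gt_eqF//; ring.
  by rewrite /m /mscale/= muleA -EFinM mulVf ?gt_eqF// mul1e.
rewrite -[LHS](@ge0_integral_pushforward _ _ _ _ R phi mphi mu setT f)//.
have l1 : 0 <= l^-1 by rewrite invr_ge0 ltW.
rewrite (eq_measure_integral (mscale (NngNum l1) mu)); last first.
  move=> A mA _. exact: pE.
by rewrite ge0_integral_mscale.
Qed.

Lemma ge0_integral_consrV n (f : 'rV[R]_n.+1 -> \bar R) :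
  measurable_fun setT f -> (forall x, 0 <= f x)%E ->
  (\int[lebesgue_rV n.+1]_x f x =
   \int[mu]_a \int[lebesgue_rV n]_v f (consrV (a, v)))%E.
Proof.
move=> mf f0.
rewrite [LHS](@ge0_integral_pushforward _ _ _ _ R (@consrV R n)
  (@measurable_consrV R n) (mu \x lebesgue_rV n)%E setT f)//.
rewrite preimage_setT fubini_tonelli1//.
  by apply: measurableT_comp => //; exact: measurable_consrV.
by move=> x; exact: f0.
Qed.

Lemma measurable_affine_rV n (c : 'rV[R]_n) (l : R) :
  measurable_fun setT (fun x : 'rV[R]_n => c + l *: x).
Proof.
apply: measurable_fun_rVP => i.
apply: (eq_measurable_fun (fun x : 'rV[R]_n => c ord0 i + l * x ord0 i)).
  by move=> x _; rewrite !mxE.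
apply: measurable_funD => //; apply: measurable_funM => //.
exact: measurable_rV_coord.
Qed.

(** By induction on the dimension: Tonelli splits off the first coordinate, and each coordinate
    contributes one factor 1/l. *)
Lemma ge0_integral_affine_rV n (f : 'rV[R]_n -> \bar R) (c : 'rV[R]_n) (l : R) :
  0 < l -> measurable_fun setT f -> (forall x, 0 <= f x)%E ->
  (\int[lebesgue_rV n]_x f (c + l *: x)%R =
   ((l ^+ n)^-1)%:E * \int[lebesgue_rV n]_x f x)%E.
Proof.
move=> l0; elim: n f c => [|n IH] f c mf f0.
  rewrite expr0 invr1 mul1e; apply: eq_integral => x _; congr f.
  by apply/rowP => -[].
have maf : measurable_fun setT (fun x : 'rV[R]_n.+1 => f (c + l *: x)).
  apply: measurableT_comp => //; exact: measurable_affine_rV.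
rewrite !ge0_integral_consrV//.
have mfc : measurable_fun setT (f \o @consrV R n).
  by apply: measurableT_comp => //; exact: measurable_consrV.
pose c' : 'rV[R]_n := \row_j c ord0 (lift ord0 j).
pose h (b : R) := (\int[lebesgue_rV n]_v f (consrV (b, v)))%E.
have h0 b : (0 <= h b)%E by apply: integral_ge0.
have mh : measurable_fun setT h.
  have := @measurable_fun_fubini_tonelli_F _ _ _ _ R (lebesgue_rV n) (f \o @consrV R n).
  by apply => // x; exact: f0.
have E (a : R) : (\int[lebesgue_rV n]_v f (c + l *: consrV (a, v))%R =
    ((l ^+ n)^-1)%:E * h (c ord0 ord0 + l * a)%R)%E.
  rewrite /h -(IH _ c')//.
    apply: eq_integral => v _; congr f; apply/rowP => i; rewrite /consrV !mxE /=.
    by case: unliftP => [j ->|->] /=; rewrite ?mxE.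
  exact: (measurableT_comp mfc (measurable_pair1 _)).
under eq_integral do rewrite E.
rewrite ge0_integralZl_EFin ?invr_ge0 ?exprn_ge0 ?ltW//; last first.
  apply: measurableT_comp => //.
  by apply: measurable_funD => //; apply: measurable_funM.
by rewrite ge0_integral_affine// muleA -EFinM exprS invfM mulrC.
Qed.

End affine_change_of_variables.

(** * Integration along segments *)

Section gradient.
Context {R : realType} {N : nat}.
Implicit Types (u : 'rV[R]_N -> R) (x a z : 'rV[R]_N).
Local Notation mu := (@lebesgue_measure R).

(** Extension by zero makes integrals over the whole space available, where translations and
    dilations act freely. *)
Definition grad_norm u : 'rV[R]_N -> R := (enorm \o grad u) \_ unit_ball.

Lemma grad_norm_ge0 u x : 0 <= grad_norm u x.
Proof. by rewrite /grad_norm patchE; case: ifP => // _; exact: enorm_ge0. Qed.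

Lemma C1_grad_continuous u x : C1_closed_unit_ball u -> unit_ball x ->
  {for x, continuous (grad u)}.
Proof.
move=> [_ _ [G cG GE]] Bx.
have := continuous_subspaceW unit_ball_sub_closed cG.
rewrite continuous_open_subspace; last exact: open_unit_ball.
move=> /(_ x (mem_set Bx)) cGx.
rewrite /prop_for/= /continuous_at -GE//.
have nB := open_nbhs_nbhs (conj (@open_unit_ball R N) Bx).
apply: (cvg_trans _ cGx); apply: near_eq_cvg; first exact: (nbhs_filter x).
by apply: (@filterS _ (nbhs x) _ _ _ _ nB) => y By; rewrite GE.
Qed.

Lemma C1_continuous u x : C1_closed_unit_ball u -> unit_ball x ->
  {for x, continuous u}.
Proof.
by move=> [_ du _] Bx; exact: (differentiable_continuous (du _ Bx)).
Qed.

Lemma measurable_C1 u : C1_closed_unit_ball u ->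
  measurable_fun setT (u \_ unit_ball).
Proof.
move=> c1; apply/(measurable_restrictT _ measurable_unit_ball).
apply: measurable_fun_continuous_open; first exact: open_unit_ball.
by move=> x Bx; exact: C1_continuous.
Qed.

Lemma continuous_enorm : continuous (@enorm R N).
Proof.
move=> x; apply: continuous_comp; first exact: continuous_sqr_enorm.
exact: sqrt_continuous.
Qed.

Lemma measurable_grad_norm u : C1_closed_unit_ball u ->
  measurable_fun setT (grad_norm u).
Proof.
move=> c1; apply/(measurable_restrictT _ measurable_unit_ball).
apply: measurable_fun_continuous_open; first exact: open_unit_ball.
move=> x Bx; apply: continuous_comp; first exact: C1_grad_continuous.
exact: continuous_enorm.
Qed.

(** Continuity up to the boundary enters here, through compactness of the closed ball; the
    finiteness of all the norms rests on it. *)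
Lemma C1_bounded u : C1_closed_unit_ball u ->
  exists L : R, [/\ 0 <= L, forall x, `|(u \_ unit_ball) x| <= L
                 & forall x, grad_norm u x <= L].
Proof.
move=> [cu _ [G cG GE]].
have bnd (f : 'rV[R]_N -> R) : {within closed_unit_ball, continuous f} ->
    exists2 L : R, 0 <= L & forall x, unit_ball x -> `|f x| <= L.
  move=> cf.
  have [M [_ HM]] := compact_bounded (continuous_compact cf compact_closed_unit_ball).
  exists (Num.max 0 (M + 1)); first by rewrite le_max lexx.
  move=> x Bx; apply: HM; first by rewrite lt_max ltrDl ltr01 orbT.
  by exists x => //; exact: unit_ball_sub_closed.
have [L1 L10 HL1] := bnd _ cu.
have [L2 L20 HL2] := bnd (@enorm R N \o G) (fun x =>
  continuous_comp (cG x) (@continuous_enorm (G x))).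
exists (Num.max L1 L2); split; first by rewrite le_max L10.
- move=> x; rewrite patchE; case: ifPn => [/set_mem Bx|_].
    by rewrite le_max HL1.
  by rewrite normr0 le_max L10.
- move=> x; rewrite /grad_norm patchE; case: ifPn => [/set_mem Bx|_].
    by rewrite le_max (le_trans _ (HL2 x Bx)) ?orbT//= GE// ler_norm.
  by rewrite le_max L10.
Qed.

Lemma diff_grad u x v : differentiable u x ->
  'd u x v = \sum_i v ord0 i * grad u x ord0 i.
Proof.
move=> du; rewrite {1}(row_sum_delta v) linear_sum; apply: eq_bigr => i _.
by rewrite linearZ/= -deriveE// mxE.
Qed.

(** Each coordinate is bounded separately; the factor N, absent from Cauchy-Schwarz, goes into the
    final constant. *)
Lemma diff_grad_le u x v : differentiable u x ->
  `|'d u x v| <= N%:R * enorm v * enorm (grad u x).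
Proof.
move=> du; rewrite diff_grad//; apply: (le_trans (ler_norm_sum _ _ _)).
have : \sum_(i < N) `|v ord0 i * grad u x ord0 i| <=
    \sum_(i < N) enorm v * enorm (grad u x).
  apply: ler_sum => i _; rewrite normrM ler_pM//; exact: le_coord_enorm.
by move=> /le_trans; apply; rewrite sumr_const card_ord -mulrA mulr_natl.
Qed.

Lemma is_derive_path u a v (m : nat) (t : R) :
  differentiable u (a + t ^+ m.+1 *: v) ->
  is_derive t 1 (fun t : R => u (a + t ^+ m.+1 *: v))
    (m.+1%:R * t ^+ m * 'd u (a + t ^+ m.+1 *: v) v).
Proof.
move=> du.
have dg : is_diff t (fun t : R => a + t ^+ m.+1 *: v)
    (fun s => (m.+1%:R * t ^+ m * s) *: v).
  have hs := is_diff_comp (@is_diffX _ _ _ _ m _ (is_diff_id t)) (is_diff_scalel _ v).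
  rewrite (_ : (fun t => _) = cst a + ( *:%R ^~ v) \o (@id R) ^+ m.+1); last first.
    by apply/funext => s; rewrite /= !fctE.
  apply: (is_diff_eq (is_diffD (is_diff_cst a t) hs)).
  by apply/funext => s; rewrite /= !fctE add0r.
have dug : is_diff (a + t ^+ m.+1 *: v) u ('d u (a + t ^+ m.+1 *: v)).
  exact/differentiableP.
have dc := is_diff_comp dg dug.
have dcd : differentiable (fun t : R => u (a + t ^+ m.+1 *: v)) t by exact: ex_diff.
split; first exact/derivable1_diffP.
by rewrite deriveE// (@diff_val _ _ _ _ _ _ _ dc)/= mulr1 linearZ.
Qed.

Lemma path_in_ball a z (m : nat) (t : R) : unit_ball a -> unit_ball z ->
  0 <= t <= 1 -> unit_ball (a + t ^+ m *: (z - a)).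
Proof.
move=> Ba Bz /andP[t0 t1]; apply: unit_ball_convex => //.
by rewrite exprn_ge0// exprn_ile1.
Qed.

Lemma measurable_path (f : 'rV[R]_N -> R) a v (m : nat) :
  measurable_fun setT f ->
  measurable_fun setT (fun t : R => f (a + t ^+ m *: v)).
Proof.
move=> mf; apply: measurableT_comp => //; apply: measurable_fun_rVP => i.
apply: (eq_measurable_fun (fun t : R => a ord0 i + t ^+ m * v ord0 i)).
  by move=> t _; rewrite !mxE.
by apply: measurable_funD => //; apply: measurable_funM.
Qed.

(* The segment is run through as t ^+ m.+1: for large m the Jacobian m.+1 * t ^+ m
   cancels the singularity t^(- m.+1 * N / q) met in Morrey's inequality, so that no
   improper integral occurs there. *)
Lemma C1_path_integral_le u a z (m : nat) : C1_closed_unit_ball u ->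
  unit_ball a -> unit_ball z ->
  (`|u z - u a|%:E <= (N%:R * enorm (z - a))%:E *
    \int[mu]_(t in `[0%R, 1%R])
      (m.+1%:R * t ^+ m * grad_norm u (a + t ^+ m.+1 *: (z - a)))%:E)%E.
Proof.
move=> c1 Ba Bz; have [_ du _] := c1.
pose g t := a + t ^+ m.+1 *: (z - a).
pose F t := u (g t).
pose f t := m.+1%:R * t ^+ m * \sum_i (z - a) ord0 i * grad u (g t) ord0 i.
have Bg (t : R) : t \in `[0, 1] -> unit_ball (g t).
  by rewrite in_itv/=; exact: path_in_ball.
have dF (t : R) : t \in `[0, 1] -> is_derive t 1 F (f t).
  move=> /Bg Bt; rewrite /f -diff_grad; last exact: du.
  by apply: is_derive_path; exact: du.
have cF (t : R) : t \in `[0, 1] -> {for t, continuous F}.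
  move=> /dF dFt; have d : derivable F t 1 by exact: ex_derive.
  by have /derivable1_diffP/differentiable_continuous := d.
have cg : continuous g.
  move=> t; apply: cvgD; first exact: cvg_cst.
  by apply: cvgZr_tmp; exact: exprn_continuous.
have cf : {within `[0, 1], continuous f}.
  apply: continuous_in_subspaceT => t /set_mem/Bg Bt.
  apply: cvgM; first by apply: cvgM; [exact: cvg_cst|exact: exprn_continuous].
  apply: (@cvg_big R _ +%R 0 _ add_continuous) => i _.
  apply: cvgM; first exact: cvg_cst.
  apply: (@continuous_comp _ _ _ (grad u \o g) (fun x : 'rV[R]_N => x ord0 i)).
    by apply: continuous_comp; [exact: cg|exact: C1_grad_continuous].
  exact: coord_cvg.
have FE : (\int[mu]_(t in `[0%R, 1%R]) (f t)%:E = (F 1)%:E - (F 0)%:E)%E.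
  apply: continuous_FTC2 => //.
  - split.
    + by move=> t t01; apply: ex_derive; apply: dF; exact: subset_itv_oo_cc.
    + by apply: cvg_at_right_filter; apply: cF; rewrite in_itv/= lexx ler01.
    + by apply: cvg_at_left_filter; apply: cF; rewrite in_itv/= lexx ler01.
  - move=> t t01; rewrite derive1E; apply: derive_val; apply: dF; exact: subset_itv_oo_cc.
have F0 : F 0 = u a by rewrite /F /g expr0n/= scale0r addr0.
have F1 : F 1 = u z by rewrite /F /g expr1n scale1r addrC subrK.
have mf : measurable_fun (`[0, 1]%classic : set R) f.
  exact: subspace_continuous_measurable_fun.
have mG : measurable_fun setT (fun t : R => m.+1%:R * t ^+ m * grad_norm u (g t)).
  apply: measurable_funM.
    by apply: measurable_funM => //; exact: exprn_measurable.
  by apply: measurable_path; exact: measurable_grad_norm.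
have c0 : 0 <= N%:R * enorm (z - a) by rewrite mulr_ge0 ?enorm_ge0.
have G0 (t : R) : 0 <= t -> 0 <= m.+1%:R * t ^+ m * grad_norm u (g t).
  by move=> t0; rewrite !mulr_ge0 ?exprn_ge0 ?grad_norm_ge0.
rewrite -F0 -F1 -abse_EFin EFinB -FE; apply: (le_trans (le_abse_integral _ _ _)) => //.
  exact/measurable_EFinP.
rewrite -ge0_integralZl_EFin//; last 2 first.
- by move=> t; rewrite /= in_itv/= => /andP[t0 _]; rewrite lee_fin G0.
- by apply/measurable_EFinP; apply: measurable_funTS.
apply: ge0_le_integral => //.
- by apply: measurableT_comp => //; exact/measurable_EFinP.
- by apply/measurable_EFinP; apply: measurable_funM => //; exact: measurable_funTS.
move=> t /= t01; rewrite lee_fin /f -diff_grad; last exact/du/Bg.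
have /andP[t0 t1] : 0 <= t <= 1 by move: t01; rewrite in_itv.
rewrite normrM ger0_norm ?mulr_ge0 ?exprn_ge0// mulrCA ler_wpM2l ?mulr_ge0 ?exprn_ge0//.
apply: (le_trans (diff_grad_le _ _)); first exact/du/Bg.
rewrite /grad_norm patchE mem_set//; exact: Bg.
Qed.

End gradient.

(** * Differences near the diagonal *)

Section near_diagonal.
Context {R : realType} {N : nat}.
Implicit Types (u : 'rV[R]_N -> R).
Local Notation mu := (@lebesgue_measure R).
Local Notation leb := (@lebesgue_rV R N).

Lemma measurable_rV_comb d (T : measurableType d) (f h : T -> 'rV[R]_N) (l : T -> R) :
  measurable_fun setT f -> measurable_fun setT l -> measurable_fun setT h ->
  measurable_fun setT (fun x => f x + l x *: h x).
Proof.
move=> mf ml mh; apply: measurable_fun_rVP => i.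
apply: (eq_measurable_fun (fun x => f x ord0 i + l x * h x ord0 i)).
  by move=> x _; rewrite !mxE.
apply: measurable_funD.
  exact: (measurableT_comp (measurable_rV_coord i)).
apply: measurable_funM => //.
exact: (measurableT_comp (measurable_rV_coord i)).
Qed.

Lemma measurable_rV_sub d (T : measurableType d) (f h : T -> 'rV[R]_N) :
  measurable_fun setT f -> measurable_fun setT h ->
  measurable_fun setT (fun x => f x - h x).
Proof.
move=> mf mh; apply: (eq_measurable_fun (fun x => f x + (-1) *: h x)).
  by move=> x _; rewrite scaleN1r.
exact: measurable_rV_comb.
Qed.

Lemma sigma_finite_lebesgue_rV2 : sigma_finite setT (leb \x leb)%E.
Proof.
pose B n : set 'rV[R]_N := ball 0 n.+1%:R.
have mB n : measurable (B n) by exact: measurable_ball_rV.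
have ndB m n x : (m <= n)%N -> B m x -> B n x.
  by move=> mn; apply: le_ball; rewrite ler_nat.
have cB x : exists n, B n x.
  exists (Num.truncn `|x|); rewrite /B -ball_normE/= sub0r normrN.
  exact: truncnS_gt.
exists (fun n => B n `*` B n).
  apply/esym; rewrite -subTset => -[x y] _.
  have [[m Bm] [n Bn]] := (cB x, cB y).
  by exists (maxn m n) => //; split;
    [apply: ndB Bm; exact: leq_maxl|apply: ndB Bn; exact: leq_maxr].
move=> n; split; first exact: measurableX.
have Bn : (leb (B n) < +oo)%E by rewrite lebesgue_rV_ball ?ltry.
by rewrite product_measure1E// lte_mul_pinfty// ge0_fin_numE.
Qed.

(* The library's sigma-finite instance for product measures is shadowed by the one
   for subprobabilities, so inference does not find it. *)
Definition lebesgue_rV2 :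
    {sigma_finite_measure set ('rV[R]_N * 'rV[R]_N)%type -> \bar R} :=
  HB.pack (leb \x leb)%E
    (Measure_isSigmaFinite.Build _ _ _ (leb \x leb)%E sigma_finite_lebesgue_rV2).

Lemma measurable_near_diagonal (r : R) : measurable
  [set z : 'rV[R]_N * 'rV[R]_N | enorm (z.1 - z.2) < r].
Proof.
rewrite -[X in measurable X]setTI.
exact: (measurable_rV_sub measurable_fst measurable_snd measurableT
  (measurable_enorm_lt r)).
Qed.

(** Substitute y = x + h. For fixed h, translation invariance makes the integral of g (x + t h) over
    x equal to that of [g], whatever t is; then h ranges over a set of measure at most (2r)^N. *)
Lemma integral_translated_average (g : 'rV[R]_N -> R) (r t : R) : 0 < r ->
  measurable_fun setT g -> (forall x, 0 <= g x) ->
  (\int[leb \x leb]_(z in [set z | (enorm (z.1 - z.2) < r)%R])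
     (g (z.1 + t *: (z.2 - z.1)))%:E
   <= ((2 * r) ^+ N)%:E * \int[leb]_x (g x)%:E)%E.
Proof.
move=> r0 mg g0.
set A := (\int[leb]_x (g x)%:E)%E.
have A0 : (0 <= A)%E by apply: integral_ge0 => x _; rewrite lee_fin.
pose E := [set h : 'rV[R]_N | enorm h < r].
have mE : measurable E by exact: measurable_enorm_lt.
have AE (h : 'rV[R]_N) : (\int[leb]_x (g (x + t *: h))%:E = A)%E.
  transitivity (\int[leb]_x (EFin \o g) (t *: h + 1 *: x)%R)%E.
    by apply: eq_integral => x _; rewrite /= scale1r addrC.
  rewrite (ge0_integral_affine_rV (t *: h) ltr01 (f := EFin \o g)).
  - by rewrite expr1n invr1 mul1e.
  - exact/measurable_EFinP.
  - by move=> x; rewrite lee_fin.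
pose phi (z : 'rV[R]_N * 'rV[R]_N) : \bar R :=
  ((\1_E (z.2 - z.1))%:E * (g (z.1 + t *: (z.2 - z.1)))%:E)%E.
have phi0 z : (0 <= phi z)%E by rewrite mule_ge0 ?lee_fin.
have msub : measurable_fun setT (fun z : 'rV[R]_N * 'rV[R]_N => z.2 - z.1).
  exact: measurable_rV_sub.
have mphi : measurable_fun setT phi.
  apply: emeasurable_funM; apply/measurable_EFinP.
    by apply: measurableT_comp => //; exact: measurable_indic.
  by apply: measurableT_comp => //; exact: measurable_rV_comb.
pose psi (z : 'rV[R]_N * 'rV[R]_N) : \bar R :=
  ((\1_E z.2)%:E * (g (z.1 + t *: z.2))%:E)%E.
have psi0 z : (0 <= psi z)%E by rewrite mule_ge0 ?lee_fin.
have mpsi : measurable_fun setT psi.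
  apply: emeasurable_funM; apply/measurable_EFinP.
    by apply: measurableT_comp => //; exact: measurable_indic.
  by apply: measurableT_comp => //; exact: measurable_rV_comb.
have -> : (\int[leb \x leb]_(z in [set z | (enorm (z.1 - z.2) < r)%R])
     (g (z.1 + t *: (z.2 - z.1)))%:E = \int[leb \x leb]_z phi z)%E.
  rewrite integral_mkcond; apply: eq_integral => z _.
  rewrite patchE /phi indicE.
  have -> : (z \in [set z | (enorm (z.1 - z.2) < r)%R]) = (z.2 - z.1 \in E).
    by apply/idP/idP => /set_mem/= H; apply/mem_set; rewrite /E/= enorm_distC.
  by case: ifP => _; rewrite ?mul1e ?mul0e.
rewrite fubini_tonelli1//.
have -> : (\int[leb]_x \int[leb]_y phi (x, y) =
           \int[leb]_x \int[leb]_h psi (x, h))%E.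
  apply: eq_integral => x _.
  transitivity (\int[leb]_h (fun y => phi (x, y)) (x + 1 *: h)%R)%E; last first.
    apply: eq_integral => h _; rewrite /phi/psi/= scale1r.
    by rewrite [x + h - x]addrC addKr.
  rewrite (ge0_integral_affine_rV x ltr01 (f := fun y => phi (x, y)))//.
  - by rewrite expr1n invr1 mul1e.
  - exact: (measurableT_comp mphi (measurable_pair1 _)).
rewrite fubini_tonelli//.
have -> : (\int[leb]_y \int[leb]_x psi (x, y) =
           \int[leb]_y (A * (\1_E y)%:E))%E.
  apply: eq_integral => y _; rewrite -(AE y) /psi/= muleC -ge0_integralZl_EFin//.
  - by move=> x _; rewrite lee_fin.
  - apply/measurable_EFinP; apply: measurableT_comp => //.
    exact: measurable_rV_comb.
rewrite ge0_integralZl//; last first.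
  by apply/measurable_EFinP; exact: measurable_indic.
rewrite integral_indic// setIT muleC lee_pmul//.
exact: lebesgue_rV_enorm_lt.
Qed.

(** The mean value bound over the segment costs N r, and for each t in [0, 1] the average of the
    gradient at x + t (y - x) is controlled by the previous lemma uniformly in t. *)
Lemma integral_difference_near_diagonal u (r : R) : 0 < r ->
  C1_closed_unit_ball u ->
  (\int[leb \x leb]_(z in (unit_ball `*` unit_ball) `&`
        [set z | (enorm (z.1 - z.2) < r)%R]) `|u z.1 - u z.2|%:E
   <= (N%:R * r * (2 * r) ^+ N)%:E * \int[leb]_x (grad_norm u x)%:E)%E.
Proof.
move=> r0 c1; set g := grad_norm u.
have mg : measurable_fun setT g by exact: measurable_grad_norm.
have g0 x : 0 <= g x by exact: grad_norm_ge0.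
set A := (\int[leb]_x (g x)%:E)%E.
have A0 : (0 <= A)%E by apply: integral_ge0 => x _; rewrite lee_fin.
pose E := [set z : 'rV[R]_N * 'rV[R]_N | enorm (z.1 - z.2) < r].
have mE : measurable E by exact: measurable_near_diagonal.
pose BB : set ('rV[R]_N * 'rV[R]_N) := unit_ball `*` unit_ball.
have mBB : measurable BB by apply: measurableX; exact: measurable_unit_ball.
pose I := `[0%R, 1%R]%classic : set R.
have mI : measurable_fun setT (\1_I : measurableTypeR R -> R).
  by apply: measurable_indic; exact: measurable_itv.
(* The domains of z and t become indicator factors, so that Tonelli applies on whole spaces. The
   restriction to the ball is dropped, which only enlarges the integral. *)
pose W (p : ('rV[R]_N * 'rV[R]_N) * measurableTypeR R) : \bar R :=
  ((\1_E p.1)%:E * ((\1_I p.2)%:E * (g (p.1.1 + p.2 *: (p.1.2 - p.1.1)))%:E))%E.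
have W0 p : (0 <= W p)%E by rewrite /W !mule_ge0 ?lee_fin.
have mgp : measurable_fun setT
    (fun p : ('rV[R]_N * 'rV[R]_N) * measurableTypeR R =>
       g (p.1.1 + p.2 *: (p.1.2 - p.1.1))).
  apply: measurableT_comp => //; apply: measurable_rV_comb => //.
  - exact: (measurableT_comp measurable_fst measurable_fst).
  - exact: (@measurable_rV_sub _ _
     (fun p : ('rV[R]_N * 'rV[R]_N) * measurableTypeR R => p.1.2)
     (fun p => p.1.1) (measurableT_comp measurable_snd measurable_fst)
     (measurableT_comp measurable_fst measurable_fst)).
have mW : measurable_fun setT W.
  apply: emeasurable_funM.
    apply/measurable_EFinP.
    by apply: (measurableT_comp (measurable_indic mE)).
  apply: emeasurable_funM; apply/measurable_EFinP => //.
  exact: (measurableT_comp mI measurable_snd).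
pose Wz z := (\int[mu]_t W (z, t))%E.
have mWz : measurable_fun setT Wz.
  exact: (measurable_fun_fubini_tonelli_F W mW W0).
have Wz0 z : (0 <= Wz z)%E by apply: integral_ge0.
have step1 : (\int[leb \x leb]_(z in BB `&` E) `|u z.1 - u z.2|%:E <=
    \int[leb \x leb]_z ((N%:R * r)%:E * Wz z))%E.
  (* Only the extension by zero is known to be measurable on the whole space; it agrees with [u] on
     the domain of integration. *)
  pose U := u \_ unit_ball.
  have mU : measurable_fun setT U by exact: measurable_C1.
  have UE x : unit_ball x -> U x = u x by move=> Bx; rewrite /U patchE mem_set.
  have -> : (\int[leb \x leb]_(z in BB `&` E) `|u z.1 - u z.2|%:E =
      \int[leb \x leb]_(z in BB `&` E) `|U z.1 - U z.2|%:E)%E.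
    by apply: eq_integral => z /set_mem[[B1 B2] _]; rewrite !UE.
  apply: (@le_trans _ _ (\int[leb \x leb]_(z in BB `&` E) ((N%:R * r)%:E * Wz z))%E);
    last first.
    apply: ge0_subset_integral => //; first exact: measurableI.
    - by apply: emeasurable_funM.
    - by move=> z _; rewrite mule_ge0// lee_fin mulr_ge0// ltW.
  apply: ge0_le_integral => //; first exact: measurableI.
  - apply/measurable_EFinP/measurable_funTS; apply: measurableT_comp => //.
    by apply: measurable_funB;
      [exact: (measurableT_comp mU measurable_fst)
      |exact: (measurableT_comp mU measurable_snd)].
  - by apply/measurable_funTS; apply: emeasurable_funM.
  move=> [x y] [[/= Bx By] xyr]; rewrite !UE// distrC.
  (* With exponent 0 the segment is run through at constant speed; no singularity has to be
     cancelled here. *)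
  apply: (le_trans (@C1_path_integral_le R N u x y 0 c1 Bx By)).
  rewrite lee_pmul//.
  - by rewrite lee_fin mulr_ge0 ?enorm_ge0.
  - by apply: integral_ge0 => t _; rewrite lee_fin expr0 mulr1 mul1r grad_norm_ge0.
  - by rewrite lee_fin ler_wpM2l// enorm_distC ltW.
  rewrite /Wz integral_mkcond le_eqVlt; apply/orP; left; apply/eqP.
  apply: eq_integral => t _; rewrite patchE /W/= !indicE (mem_set xyr) mul1e.
  by case: ifP => _; rewrite ?mul0e ?mul1e// expr0 mulr1 mul1r expr1.
apply: (le_trans step1).
rewrite ge0_integralZl_EFin ?mulr_ge0 ?(ltW r0)//.
rewrite [((N%:R * r * _)%:E)]EFinM -muleA.
apply: lee_wpmul2l; first by rewrite lee_fin mulr_ge0// ltW.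
have -> : (\int[leb \x leb]_z Wz z = \int[mu]_t \int[leb \x leb]_z W (z, t))%E.
  exact: (@fubini_tonelli _ _ _ _ R lebesgue_rV2 mu W mW W0).
have K0 : (0 <= ((2 * r) ^+ N)%:E * A)%E.
  by rewrite mule_ge0// lee_fin exprn_ge0// mulr_ge0// ltW.
apply: (@le_trans _ _ (\int[mu]_t ((((2 * r) ^+ N)%:E * A) * (\1_I t)%:E))%E).
  apply: ge0_le_integral => //.
  - by move=> t _; apply: integral_ge0.
  - exact: (@measurable_fun_fubini_tonelli_G _ _ _ _ R lebesgue_rV2 W mW W0).
  - by apply: emeasurable_funM => //; exact/measurable_EFinP.
  move=> t _.
  have -> : (\int[leb \x leb]_z W (z, t) = (\1_I t)%:E *
      \int[leb \x leb]_(z in E) (g (z.1 + t *: (z.2 - z.1)))%:E)%E.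
    rewrite [in RHS]integral_mkcond -ge0_integralZl_EFin//.
    - apply: eq_integral => z _; rewrite /W/= patchE indicE.
      by case: ifP => _; rewrite ?mul1e ?mul0e ?mule0.
    - by move=> z _; rewrite patchE; case: ifP => // _; rewrite lee_fin.
    - apply/(measurable_restrictT _ mE)/measurable_funTS/measurable_EFinP.
      exact: (measurableT_comp mgp (measurable_pair2 t)).
  rewrite muleC; apply: lee_wpmul2r; first by rewrite lee_fin.
  exact: integral_translated_average.
rewrite ge0_integralZl//; last exact/measurable_EFinP.
have mIs : measurable I by exact: measurable_itv.
rewrite integral_indic// setIT.
have muI : mu I = 1%E by rewrite /I lebesgue_measure_itv/= lte_fin ltr01 oppr0 adde0.
by rewrite [X in (_ * X <= _)%E](_ : _ = 1%E)// mule1.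
Qed.

End near_diagonal.

(** * Morrey's inequality *)

Section morrey.
Context {R : realType} {N : nat}.
Implicit Types (u : 'rV[R]_N -> R) (a c x y : 'rV[R]_N).
Local Notation mu := (@lebesgue_measure R).
Local Notation leb := (@lebesgue_rV R N).

Definition ball_volume : R := fine (leb unit_ball).

Lemma lebesgue_rV_unit_ballE : leb unit_ball = ball_volume%:E.
Proof. by rewrite fineK// ge0_fin_numE// lebesgue_rV_unit_ball_lty. Qed.

Lemma ball_volume_gt0 : 0 < ball_volume.
Proof.
rewrite -lte_fin -lebesgue_rV_unit_ballE.
apply: (@lebesgue_rV_open_gt0 _ _ _ 0); first exact: open_unit_ball.
by rewrite /unit_ball/= enorm0.
Qed.

(* Integrated with [k] proportional to the L^q norm of [s], this gives the L^1 bound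
   on the ball that Hölder's inequality would. *)
Lemma le_level_powR (s k q : R) : 0 <= s -> 0 < k -> 1 <= q ->
  s <= k + k * (s / k) `^ q.
Proof.
move=> s0 k0 q1; have [sk|/ltW ks] := leP s k.
  by rewrite (le_trans sk)// lerDl mulr_ge0 ?powR_ge0// ltW.
have sk1 : 1 <= s / k by rewrite ler_pdivlMr// mul1r.
apply: (@le_trans _ _ (k * (s / k) `^ q)); last by rewrite lerDr ltW.
by rewrite -ler_pdivrMl// mulrC le1r_powR.
Qed.

Lemma integral_ball_affine_le (g : 'rV[R]_N -> R) (q b l : R) c :
  measurable_fun setT g -> (forall x, 0 <= g x) -> 1 <= q -> 0 < b -> 0 < l ->
  (\int[leb]_x (g x `^ q)%:E <= (b `^ q)%:E)%E ->
  (\int[leb]_(w in unit_ball) (g (c + l *: w))%:E <=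
    ((ball_volume + 1) * (l `^ (- (N%:R / q)) * b))%:E)%E.
Proof.
move=> mg g0 q1 b0 l0 gb.
have q0 : 0 < q by exact: lt_le_trans q1.
(* By scaling, g (c + l w) has q-th power integral at most l^-N b^q, which is exactly k^q; the level
   inequality then integrates to k times the volume plus k. *)
pose k := l `^ (- (N%:R / q)) * b.
have k0 : 0 < k by rewrite mulr_gt0// powR_gt0.
have kq : k `^ q = (l ^+ N)^-1 * b `^ q.
  rewrite powRM ?powR_ge0 ?(ltW b0)// -powRrM mulNr divfK ?gt_eqF//.
  by rewrite powRN powR_mulrn// ltW.
have mgq : measurable_fun setT (fun x => g x `^ q).
  by apply: (measurableT_comp (measurable_powR q)).
have mgl : measurable_fun setT (fun w : 'rV[R]_N => g (c + l *: w)).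
  by apply: measurableT_comp => //; exact: measurable_affine_rV.
have mgql : measurable_fun setT (fun w : 'rV[R]_N => g (c + l *: w) `^ q).
  by apply: (measurableT_comp (measurable_powR q)).
have mB := @measurable_unit_ball R N.
apply: (@le_trans _ _ (\int[leb]_(w in unit_ball)
    (k%:E + (k / k `^ q)%:E * (g (c + l *: w) `^ q)%:E))%E).
  apply: ge0_le_integral => //.
  - by move=> w _; rewrite lee_fin.
  - exact/measurable_EFinP/measurable_funTS.
  - apply: emeasurable_funD => //; apply: emeasurable_funM => //.
    exact/measurable_EFinP/measurable_funTS.
  - move=> w _; rewrite -EFinM -EFinD lee_fin.
    apply: (le_trans (le_level_powR (g0 _) k0 q1)).
    rewrite lerD2l powRM ?invr_ge0 ?(ltW k0)// -[k^-1]powR_inv1 ?(ltW k0)//.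
    by rewrite -powRrM mulN1r (powRN k) mulrCA mulrC.
rewrite ge0_integralD//; last 3 first.
- by move=> w _; rewrite lee_fin ltW.
- by move=> w _; rewrite mule_ge0// lee_fin ?powR_ge0// divr_ge0 ?powR_ge0 ?ltW.
- by apply: emeasurable_funM => //; exact/measurable_EFinP/measurable_funTS.
rewrite integral_cst// [X in (_ * X + _)%E]lebesgue_rV_unit_ballE.
rewrite ge0_integralZl_EFin//; last 3 first.
- by move=> w _; rewrite lee_fin powR_ge0.
- exact/measurable_EFinP/measurable_funTS.
- by rewrite divr_ge0 ?powR_ge0 ?(ltW k0).
rewrite mulrDl mul1r EFinD leeD//; first by rewrite -EFinM mulrC.
apply: (@le_trans _ _ ((k / k `^ q)%:E * ((l ^+ N)^-1 * b `^ q)%:E)%E); last first.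
  by rewrite -kq -EFinM divfK// gt_eqF// powR_gt0.
apply: lee_wpmul2l; first by rewrite lee_fin divr_ge0 ?powR_ge0 ?(ltW k0).
apply: (@le_trans _ _ (\int[leb]_w (g (c + l *: w) `^ q)%:E)%E).
  apply: ge0_subset_integral => //; last by move=> w _; rewrite lee_fin powR_ge0.
  exact/measurable_EFinP.
rewrite (ge0_integral_affine_rV c l0 (f := fun x => (g x `^ q)%:E))//.
- by rewrite EFinM; apply: lee_wpmul2l => //; rewrite lee_fin invr_ge0 exprn_ge0// ltW.
- exact/measurable_EFinP.
- by move=> w; rewrite lee_fin powR_ge0.
Qed.

(** For fixed t the point at parameter t of the path from [a] is affine in w with ratio t^(m+1) s,
    so the affine bound yields (t^(m+1) s)^(-N/q). The hypothesis on [m] says that the Jacobian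
    (m+1) t^m compensates the power of t. The base point [a] is kept apart from x because both
    endpoints of a difference are needed in turn. *)
Lemma integral_ball_difference_le u (q b s d : R) (m : nat) a x :
  C1_closed_unit_ball u -> 1 <= q -> 0 < b ->
  (\int[leb]_x (grad_norm u x `^ q)%:E <= (b `^ q)%:E)%E ->
  (0 < m)%N -> m.+1%:R * (N%:R / q) <= m%:R -> 0 < s <= 1 ->
  unit_ball a -> unit_ball x ->
  (forall w, unit_ball w -> enorm (x + s *: (w - x) - a) <= d) ->
  (\int[leb]_(w in unit_ball) `|u (x + s *: (w - x)) - u a|%:E <=
    (N%:R * d * (m.+1%:R * ((ball_volume + 1) * (s `^ (- (N%:R / q)) * b))))%:E)%E.
Proof.
move=> c1 q1 b0 gb m0 mq /andP[s0 s1] Ba Bx Zd; set g := grad_norm u.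
have mg : measurable_fun setT g by exact: measurable_grad_norm.
have g0 y : 0 <= g y by exact: grad_norm_ge0.
have mB := @measurable_unit_ball R N.
have d0 : 0 <= d by apply: le_trans (Zd _ Bx); exact: enorm_ge0.
pose Z (w : 'rV[R]_N) := x + s *: (w - x).
have BZ w : unit_ball w -> unit_ball (Z w).
  by move=> Bw; apply: unit_ball_convex => //; rewrite (ltW s0) s1.
have mZ : measurable_fun setT Z.
  by apply: measurable_rV_comb => //; exact: measurable_rV_sub.
pose I := `[0%R, 1%R]%classic : set R.
have mI : measurable_fun setT (\1_I : measurableTypeR R -> R).
  by apply: measurable_indic; exact: measurable_itv.
pose G (p : 'rV[R]_N * measurableTypeR R) := g (a + p.2 ^+ m.+1 *: (Z p.1 - a)).
have G0 p : 0 <= G p by exact: g0.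
have mG : measurable_fun setT G.
  apply: measurableT_comp => //; apply: measurable_rV_comb => //.
  - exact: (measurable_funX m.+1 (measurable_snd (T1 := 'rV[R]_N))).
  - apply: measurable_rV_sub => //.
    exact: (measurableT_comp mZ measurable_fst).
pose h (t : measurableTypeR R) : R := \1_I t * (m.+1%:R * t ^+ m).
have h0 t : 0 <= h t.
  rewrite /h indicE; have [/set_mem|_] := boolP (t \in I); last by rewrite mul0r.
  by rewrite /I/= in_itv/= => /andP[t0 _]; rewrite mul1r mulr_ge0// exprn_ge0.
have mh : measurable_fun setT h.
  by apply: (measurable_funM mI); apply: measurable_funM.
pose W (p : 'rV[R]_N * measurableTypeR R) : \bar R :=
  ((\1_unit_ball p.1)%:E * ((h p.2)%:E * (G p)%:E))%E.
have W0 p : (0 <= W p)%E by rewrite /W !mule_ge0 ?lee_fin.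
have mW : measurable_fun setT W.
  apply: emeasurable_funM.
    by apply/measurable_EFinP; apply: (measurableT_comp (measurable_indic mB)).
  apply: emeasurable_funM; apply/measurable_EFinP => //.
  exact: (measurableT_comp mh measurable_snd).
pose Ww w := (\int[mu]_t W (w, t))%E.
have mWw : measurable_fun setT Ww.
  exact: (measurable_fun_fubini_tonelli_F W mW W0).
have Ww0 w : (0 <= Ww w)%E by apply: integral_ge0.
have step1 : (\int[leb]_(w in unit_ball) `|u (Z w) - u a|%:E <=
    \int[leb]_w ((N%:R * d)%:E * Ww w))%E.
  pose U := u \_ unit_ball.
  have mU : measurable_fun setT U by exact: measurable_C1.
  have UE y : unit_ball y -> U y = u y by move=> By; rewrite /U patchE mem_set.
  have -> : (\int[leb]_(w in unit_ball) `|u (Z w) - u a|%:E =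
      \int[leb]_(w in unit_ball) `|U (Z w) - u a|%:E)%E.
    by apply: eq_integral => w /set_mem Bw; rewrite UE//; exact: BZ.
  apply: (@le_trans _ _ (\int[leb]_(w in unit_ball) ((N%:R * d)%:E * Ww w))%E);
    last first.
    apply: ge0_subset_integral => //.
    - by apply: emeasurable_funM.
    - by move=> w _; rewrite mule_ge0// lee_fin mulr_ge0.
  apply: ge0_le_integral => //.
  - apply/measurable_EFinP/measurable_funTS; apply: measurableT_comp => //.
    by apply: measurable_funB => //; exact: (measurableT_comp mU mZ).
  - by apply/measurable_funTS; apply: emeasurable_funM.
  move=> w Bw; rewrite UE; last exact: BZ.
  apply: (le_trans (@C1_path_integral_le R N u a (Z w) m c1 Ba (BZ _ Bw))).
  rewrite lee_pmul//.
  - by rewrite lee_fin mulr_ge0 ?enorm_ge0.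
  - apply: integral_ge0 => t; rewrite /= in_itv/= => /andP[t0 _].
    by rewrite lee_fin !mulr_ge0 ?exprn_ge0 ?grad_norm_ge0.
  - by rewrite lee_fin ler_wpM2l//; exact: Zd.
  rewrite /Ww integral_mkcond le_eqVlt; apply/orP; left; apply/eqP.
  apply: eq_integral => t _; rewrite patchE /W/= /h !indicE (mem_set Bw) mul1e.
  by case: ifP => _; rewrite ?mul0r ?mul0e// mul1r -EFinM.
apply: (le_trans step1).
rewrite ge0_integralZl_EFin ?mulr_ge0//.
rewrite [(N%:R * d * _)%:E]EFinM.
apply: lee_wpmul2l; first by rewrite lee_fin mulr_ge0.
set K := m.+1%:R * _.
have K0 : 0 <= K.
  by rewrite !mulr_ge0 ?addr_ge0 ?powR_ge0 ?(ltW b0) ?(ltW ball_volume_gt0).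
have -> : (\int[leb]_w Ww w = \int[mu]_t \int[leb]_w W (w, t))%E.
  exact: (@fubini_tonelli _ _ _ _ R leb mu W mW W0).
apply: (@le_trans _ _ (\int[mu]_t (K%:E * (\1_I t)%:E))%E); last first.
  rewrite ge0_integralZl_EFin//; last exact/measurable_EFinP.
  have mIs : measurable I by exact: measurable_itv.
  rewrite integral_indic// setIT.
  have muI : mu I = 1%E by rewrite /I lebesgue_measure_itv/= lte_fin ltr01 oppr0 adde0.
  by rewrite [X in (_ * X <= _)%E](_ : _ = 1%E)// mule1.
apply: ge0_le_integral => //.
- by move=> t _; apply: integral_ge0.
- exact: (@measurable_fun_fubini_tonelli_G _ _ _ _ R leb W mW W0).
- by apply: emeasurable_funM => //; exact/measurable_EFinP.
move=> t _.
have -> : (\int[leb]_w W (w, t) = (h t)%:E *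
    \int[leb]_(w in unit_ball) (G (w, t))%:E)%E.
  rewrite [in RHS]integral_mkcond -ge0_integralZl_EFin//.
  - apply: eq_integral => w _; rewrite /W/= patchE indicE.
    by case: ifP => _; rewrite ?mul1e ?mul0e ?mule0.
  - by move=> w _; rewrite patchE; case: ifP => // _; rewrite lee_fin.
  - apply/(measurable_restrictT _ mB)/measurable_funTS/measurable_EFinP.
    exact: (measurableT_comp mG (measurable_pair2 t)).
rewrite /h indicE; have [/set_mem|_] := boolP (t \in I); last first.
  by rewrite mul0r mul0e mule0.
rewrite /I/= in_itv/= => /andP[t0 t1]; rewrite mul1r mule1.
(* At t = 0 the dilation degenerates, but the Jacobian vanishes there because m > 0. *)
move: t0; rewrite le_eqVlt => /predU1P[<-|t0].
  by rewrite expr0n gtn_eqF// mulr0 mul0e lee_fin.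
have tm0 : 0 < t ^+ m.+1 * s by rewrite mulr_gt0// exprn_gt0.
have -> : (\int[leb]_(w in unit_ball) (G (w, t))%:E =
    \int[leb]_(w in unit_ball)
      (g ((a + t ^+ m.+1 *: (x - s *: x - a)) + (t ^+ m.+1 * s) *: w))%:E)%E.
  apply: eq_integral => w _; rewrite /G/= /Z; congr (g _)%:E.
  by apply/rowP => i; rewrite !mxE; ring.
apply: (@le_trans _ _ ((m.+1%:R * t ^+ m)%:E * ((ball_volume + 1) *
    ((t ^+ m.+1 * s) `^ (- (N%:R / q)) * b))%:E)%E).
  apply: lee_wpmul2l; first by rewrite lee_fin mulr_ge0// exprn_ge0// ltW.
  exact: integral_ball_affine_le.
rewrite -EFinM lee_fin /K -mulrA ler_wpM2l//.
rewrite mulrCA ler_wpM2l ?addr_ge0 ?(ltW ball_volume_gt0)//.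
rewrite mulrA ler_wpM2r ?(ltW b0)//.
rewrite powRM ?exprn_ge0 ?(ltW t0) ?(ltW s0)// mulrA.
(* What is left is t^(m - (m+1) N/q) <= 1, true for 0 < t <= 1 since the exponent is nonnegative. *)
rewrite ler_piMl ?powR_ge0// -!powR_mulrn ?(ltW t0)// -powRrM.
rewrite -powRD; last by rewrite (gt_eqF t0) implybT.
rewrite mulrN -[leRHS](powRr0 t); apply: ger_powR; first by rewrite t0.
by rewrite subr_ge0.
Qed.

(* With s = |x - y| / 2, average |u x - u y| <= |u z - u x| + |u z - u y| over the
   points z = x + s (w - x), w in the ball: they stay in the ball by convexity and lie
   within 2 |x - y| of both x and y. *)
Lemma morrey (q : R) : (1 <= N)%N -> N%:R < q -> exists2 K : R, 0 <= K &
  forall u (b : R), C1_closed_unit_ball u -> 0 < b ->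
  (\int[leb]_x (grad_norm u x `^ q)%:E <= (b `^ q)%:E)%E ->
  forall x y, unit_ball x -> unit_ball y ->
  `|u x - u y| <= K * b * enorm (x - y) `^ (1 - N%:R / q).
Proof.
move=> hN Nq.
have n1 : 1 <= N%:R :> R by rewrite ler1n.
have q1 : 1 <= q by rewrite (le_trans n1)// ltW.
have q0 : 0 < q by exact: lt_le_trans q1.
pose c := N%:R / q.
have c0 : 0 < c by rewrite divr_gt0// (lt_le_trans _ n1).
have c1 : c < 1 by rewrite ltr_pdivrMr// mul1r.
(* The condition reads c <= m (1 - c). As c < 1, any m >= 1/(1 - c) gives m (1 - c) >= 1 > c. *)
have [m m0 mc] : exists2 m, (0 < m)%N & m.+1%:R * c <= m%:R.
  exists (Num.truncn (1 - c)^-1).+1 => //.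
  have := truncnS_gt (1 - c)^-1; set k := (Num.truncn _).+1 => /ltW ck.
  rewrite -[k.+1]addn1 natrD mulrDl mul1r -lerBrDl -{1}(mulr1 k%:R) -mulrBr.
  have k1 : 1 <= k%:R * (1 - c) by rewrite -ler_pdivrMr ?subr_gt0// mul1r.
  by rewrite (le_trans (ltW c1)).
pose V := ball_volume.
have V0 : 0 < V by exact: ball_volume_gt0.
pose K1 := N%:R * m.+1%:R * (V + 1).
have K10 : 0 <= K1 by rewrite !mulr_ge0// addr_ge0// ltW.
(* The two averages, each with distance bound 2r, give 4 K1 / V; the last factor 2 bounds 2^c in r
   s^(-c) = 2^c r^(1-c), where s = r/2. *)
exists (8 * K1 / V); first by rewrite divr_ge0 ?(ltW V0)// mulr_ge0.
move=> u b C1u b0 gb x y Bx By.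
have [<-|xy] := eqVneq x y.
  by rewrite !subrr normr0 !mulr_ge0 ?invr_ge0 ?addr_ge0 ?(ltW V0) ?(ltW b0) ?powR_ge0.
pose r := enorm (x - y).
have r0 : 0 < r by apply: enorm_gt0; rewrite subr_eq0.
pose s := r / 2.
have s0 : 0 < s by rewrite divr_gt0.
have s1 : s <= 1 by rewrite ler_pdivrMr// mul1r ltW// unit_ball_dist.
have mB := @measurable_unit_ball R N.
pose Z (w : 'rV[R]_N) := x + s *: (w - x).
have Zx w : unit_ball w -> enorm (Z w - x) <= r.
  move=> Bw; rewrite /Z addrC addKr enormZ gtr0_norm//.
  by rewrite mulrAC ler_pdivrMr// ler_wpM2l ?(ltW r0)// ltW// unit_ball_dist.
have Zy w : unit_ball w -> enorm (Z w - y) <= 2 * r.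
  move=> /Zx Zwx; rewrite -(@ler_pXn2r _ 2) ?nnegrE ?enorm_ge0 ?mulr_ge0 ?(ltW r0)//.
  rewrite -(subrKA x); apply: (le_trans (sqr_enormD_le _ _)).
  have : enorm (Z w - x) ^+ 2 <= r ^+ 2 by rewrite ler_pXn2r ?nnegrE ?enorm_ge0 ?(ltW r0).
  by rewrite -/r exprMn; lra.
have s01 : 0 < s <= 1 by rewrite s0.
have Ix := integral_ball_difference_le C1u q1 b0 gb m0 mc s01 Bx Bx
  (fun w Bw => le_trans (Zx w Bw) (_ : r <= 2 * r)).
have r2r : r <= 2 * r by lra.
have {}Ix := Ix r2r.
have Iy := integral_ball_difference_le C1u q1 b0 gb m0 mc s01 By Bx Zy.
set J := N%:R * (2 * r) * _ in Ix Iy.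
pose U := u \_ unit_ball.
have mU : measurable_fun setT U by exact: measurable_C1.
have UE z : unit_ball z -> U z = u z by move=> Bz; rewrite /U patchE mem_set.
have BZ w : unit_ball w -> unit_ball (Z w).
  by move=> Bw; apply: unit_ball_convex => //; rewrite (ltW s0) s1.
have mZ : measurable_fun setT Z.
  by apply: measurable_rV_comb => //; exact: measurable_rV_sub.
have mUa (a : R) : measurable_fun unit_ball (fun w => `|U (Z w) - a|%:E).
  apply/measurable_EFinP/measurable_funTS; apply: measurableT_comp => //.
  by apply: measurable_funB => //; exact: (measurableT_comp mU mZ).
have : (`|u x - u y|%:E * V%:E <= (J + J)%:E)%E.
  rewrite -lebesgue_rV_unit_ballE -(integral_cst leb mB).
  apply: (@le_trans _ _ (\int[leb]_(w in unit_ball)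
      (`|U (Z w) - u x|%:E + `|U (Z w) - u y|%:E))%E).
    apply: ge0_le_integral => //.
    - by move=> w _; rewrite lee_fin.
    - by apply: emeasurable_funD; exact: mUa.
    - move=> w Bw; rewrite -EFinD lee_fin /cst/=.
      by rewrite -(subrKA (U (Z w))) (le_trans (ler_normD _ _))// lerD2r distrC.
  rewrite ge0_integralD//; try exact: mUa; try by move=> w _; rewrite lee_fin.
  have UZ (a : R) : (\int[leb]_(w in unit_ball) `|U (Z w) - a|%:E =
      \int[leb]_(w in unit_ball) `|u (Z w) - a|%:E)%E.
    by apply: eq_integral => w /set_mem Bw; rewrite UE//; exact: BZ.
  by rewrite !UZ EFinD leeD.
rewrite -EFinM lee_fin -ler_pdivlMr// => /le_trans; apply.
have sr : r * s `^ (- c) <= 2 * r `^ (1 - c).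
  rewrite powRD; last by rewrite (gt_eqF r0) implybT.
  rewrite powRr1 ?(ltW r0)// mulrCA ler_wpM2l ?(ltW r0)//.
  rewrite powRM ?(ltW r0) ?invr_ge0// mulrC ler_wpM2r ?powR_ge0//.
  rewrite -powR_inv1// -powRrM mulN1r opprK -[leRHS]powRr1//.
  by rewrite ler_powR ?ler1n// ltW.
have -> : (J + J) / V = 4 * K1 / V * b * (r * s `^ (- c)).
  by rewrite /J /K1 /V; ring.
have -> : 8 * K1 / V * b * r `^ (1 - c) = 4 * K1 / V * b * (2 * r `^ (1 - c)) by ring.
by rewrite ler_wpM2l// !mulr_ge0 ?invr_ge0 ?addr_ge0 ?(ltW V0) ?(ltW b0).
Qed.

End morrey.

(** * Summation over dyadic shells *)

Section dyadic.
Context {R : realType} {N : nat}.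
Implicit Types (u : 'rV[R]_N -> R).
Local Notation leb := (@lebesgue_rV R N).

(** The least k with 2^-k <= d works: minimality gives the upper bound, except for k = 0, where it
    is d < 2, the diameter of the ball. *)
Lemma dyadic_scale (d : R) : 0 < d < 2 ->
  exists k : nat, 2^-1 ^+ k <= d < 2 * 2^-1 ^+ k.
Proof.
move=> /andP[d0 d2].
have ex : exists k : nat, 2^-1 ^+ k <= d :> R.
  exists (Num.truncn d^-1).+1.
  rewrite exprVn -[leRHS]invrK lef_pV2 ?posrE ?invr_gt0 ?exprn_gt0//.
  apply: (le_trans (ltW (truncnS_gt _))).
  by rewrite -natrX ler_nat ltnW// ltn_expl.
case: (ex_minnP ex) => -[k0 _|k k1 kmin].
  by exists 0%N; rewrite k0 expr0 mulr1.
exists k.+1; rewrite k1/= exprS mulrA divff// mul1r ltNge.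
by apply/negP => /kmin; rewrite ltnn.
Qed.

Lemma integral_grad_norm_powR_lty u (q : R) : C1_closed_unit_ball u -> 0 < q ->
  (\int[leb]_x (grad_norm u x `^ q)%:E < +oo)%E.
Proof.
move=> c1 q0; have [L [L0 _ gL]] := C1_bounded c1.
have mB := @measurable_unit_ball R N.
have -> : (\int[leb]_x (grad_norm u x `^ q)%:E =
    \int[leb]_(x in unit_ball) (grad_norm u x `^ q)%:E)%E.
  rewrite [RHS]integral_mkcond; apply: eq_integral => x _; rewrite patchE.
  by case: ifPn => // xB; rewrite /grad_norm patchE (negbTE xB) powR0 ?gt_eqF.
apply: (@le_lt_trans _ _ (\int[leb]_(x in unit_ball) (L `^ q)%:E)%E).
  apply: ge0_le_integral => //.
  - by move=> x _; rewrite lee_fin powR_ge0.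
  - apply/measurable_EFinP/measurable_funTS.
    by apply: (measurableT_comp (measurable_powR q)); exact: measurable_grad_norm.
  move=> x _; rewrite lee_fin ge0_ler_powR ?nnegrE ?grad_norm_ge0//.
  exact: ltW.
by rewrite integral_cst// [X in (_ * X)%E]lebesgue_rV_unit_ballE -EFinM ltry.
Qed.

(** The oscillation bounds [m] are left abstract, so that the trivial bound and Morrey's can be
    mixed. Each shell is enlarged to the full neighbourhood |x - y| < rho k of the diagonal, where
    the L^1 estimate has the right order anyway. *)
Lemma gagliardo_integral_le u (p : R) (m : nat -> R) :
  C1_closed_unit_ball u -> 1 < p ->
  (forall k x y, unit_ball x -> unit_ball y ->
     enorm (x - y) < 2 * 2^-1 ^+ k -> `|u x - u y| <= m k) ->
  (\int[leb \x leb]_(z in unit_ball `*` unit_ball)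
      (`|u z.1 - u z.2| `^ p / enorm (z.1 - z.2) ^+ N.+1)%:E
   <= (N%:R * 2 * 4 ^+ N)%:E * \int[leb]_x (grad_norm u x)%:E *
      \sum_(0 <= k <oo) (m k `^ (p - 1))%:E)%E.
Proof.
move=> c1 p1 um.
have p0 : 0 < p by lra.
pose BB : set ('rV[R]_N * 'rV[R]_N) := unit_ball `*` unit_ball.
have mBB : measurable BB by apply: measurableX; exact: measurable_unit_ball.
pose U := u \_ unit_ball.
have mU : measurable_fun setT U by exact: measurable_C1.
have UE x : unit_ball x -> U x = u x by move=> Bx; rewrite /U patchE mem_set.
pose rho (k : nat) : R := 2 * 2^-1 ^+ k.
have rho0 k : 0 < rho k by rewrite mulr_gt0// exprn_gt0// invr_gt0.
pose E k := [set z : 'rV[R]_N * 'rV[R]_N | enorm (z.1 - z.2) < rho k].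
have mE k : measurable (E k) by exact: measurable_near_diagonal.
pose dU (z : 'rV[R]_N * 'rV[R]_N) := `|U z.1 - U z.2|.
have mdU : measurable_fun setT dU.
  apply: measurableT_comp => //; apply: measurable_funB.
    exact: (measurableT_comp mU measurable_fst).
  exact: (measurableT_comp mU measurable_snd).
(* On the k-th shell |x - y| >= rho k / 2, which bounds the kernel; p - 1 of the p factors |u x - u
   y| are replaced by the oscillation bound. *)
pose c k := (2 / rho k) ^+ N.+1 * m k `^ (p - 1).
have c0 k : 0 <= c k.
  by rewrite mulr_ge0 ?powR_ge0// exprn_ge0// divr_ge0// ltW.
pose F k z : \bar R := ((c k)%:E * ((\1_(E k) z)%:E * (dU z)%:E))%E.
have F0 k z : (0 <= F k z)%E by rewrite /F /dU !mule_ge0 ?lee_fin.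
have mF k : measurable_fun setT (F k).
  by apply: emeasurable_funM => //; apply: emeasurable_funM; exact/measurable_EFinP.
(* The inverse distance is written as a power so that measurability follows by composition; both
   conventions give 0 on the diagonal. *)
pose f (z : 'rV[R]_N * 'rV[R]_N) := dU z `^ p * (enorm (z.1 - z.2) `^ (-1)) ^+ N.+1.
have -> : (\int[leb \x leb]_(z in unit_ball `*` unit_ball)
      (`|u z.1 - u z.2| `^ p / enorm (z.1 - z.2) ^+ N.+1)%:E =
   \int[leb \x leb]_(z in BB) (f z)%:E)%E.
  apply: eq_integral => z /set_mem[B1 B2].
  by rewrite /f /dU !UE// powR_inv1 ?enorm_ge0// exprVn.
have mf : measurable_fun setT f.
  apply: measurable_funM; first exact: (measurableT_comp (measurable_powR p)).
  apply: measurable_funX; apply: (measurableT_comp (measurable_powR (-1))).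
  apply: (measurableT_comp (f := @enorm R N)).
    apply: measurable_fun_continuous_open; first exact: openT.
    by move=> x _; exact: continuous_enorm.
  exact: measurable_rV_sub.
have fF z : BB z -> ((f z)%:E <= \sum_(0 <= k <oo) F k z)%E.
  case: z => x y [/= Bx By].
  (* The diagonal lies in no shell, but the integrand is 0 there because p > 0. *)
  have [xy|xy] := eqVneq x y.
    rewrite /f /dU xy/= subrr normr0 powR0 ?gt_eqF// mul0r.
    by apply: nneseries_ge0.
  have d0 : 0 < enorm (x - y) by apply: enorm_gt0; rewrite subr_eq0.
  have [k /andP[k1 k2]] : exists k : nat, 2^-1 ^+ k <= enorm (x - y) < 2 * 2^-1 ^+ k.
    by apply: dyadic_scale; rewrite d0 unit_ball_dist.
  apply: (@le_trans _ _ (F k (x, y))); last first.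
    apply: le_trans (nneseries_lim_ge k.+1 _) => //.
    by rewrite big_nat_recr//= leeDr// sume_ge0.
  rewrite /F indicE mem_set// mul1e -EFinM lee_fin /f /dU/= !UE//.
  have := um k x y Bx By k2; set s := `|_| => sm.
  have s0 : 0 <= s by exact: normr_ge0.
  rewrite -(mulr_powRB1 s0 p0) mulrC mulrCA [leRHS]mulrC ler_wpM2l//.
  rewrite mulrC /c mulrC ler_pM ?powR_ge0 ?exprn_ge0 ?powR_ge0//.
    apply: lerXn2r; rewrite ?nnegrE ?powR_ge0 ?divr_ge0 ?(ltW (rho0 k))//.
    rewrite powR_inv1 ?enorm_ge0// /rho invfM mulrA divff// mul1r.
    by rewrite lef_pV2 ?posrE// exprn_gt0// invr_gt0.
  apply: ge0_ler_powR; rewrite ?nnegrE ?subr_ge0 ?(ltW p1)//.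
  exact: le_trans sm.
set A := (\int[leb]_x (grad_norm u x)%:E)%E.
have A0 : (0 <= A)%E by apply: integral_ge0 => x _; rewrite lee_fin grad_norm_ge0.
have FA k : (\int[leb \x leb]_(z in BB) F k z <=
    (N%:R * 2 * 4 ^+ N)%:E * A * (m k `^ (p - 1))%:E)%E.
  rewrite ge0_integralZl_EFin//; last 2 first.
  - by move=> z _; rewrite /dU mule_ge0 ?lee_fin.
  - by apply/measurable_funTS; apply: emeasurable_funM; exact/measurable_EFinP.
  have -> : (\int[leb \x leb]_(z in BB) ((\1_(E k) z)%:E * (dU z)%:E) =
      \int[leb \x leb]_(z in BB `&` E k) `|u z.1 - u z.2|%:E)%E.
    rewrite [RHS]integral_mkcondr; apply: eq_integral => z /set_mem[B1 B2].
    rewrite patchE indicE /dU !UE//.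
    by case: ifP => _; rewrite ?mul1e ?mul0e.
  apply: (@le_trans _ _ ((c k)%:E * ((N%:R * rho k * (2 * rho k) ^+ N)%:E * A))%E).
    apply: lee_wpmul2l; first by rewrite lee_fin.
    exact: integral_difference_near_diagonal.
  rewrite muleA -EFinM [leRHS]muleAC -EFinM.
  rewrite (_ : c k * _ = N%:R * 2 * 4 ^+ N * m k `^ (p - 1))// /c.
  have r0 : rho k != 0 by rewrite gt_eqF.
  (* The powers of rho k cancel: N + 1 from the kernel against N + 1 from the neighbourhood of the
     diagonal. *)
  have <- : 2 / rho k * (2 * rho k) = 4 by field.
  rewrite [in RHS]exprMn exprS; move: (_ ^+ N) (_ ^+ N) (m k `^ _) => X Y Z.
  by field.
apply: (@le_trans _ _ (\int[leb \x leb]_(z in BB) (\sum_(0 <= k <oo) F k z))%E).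
  apply: ge0_le_integral => //.
  - by move=> z _; rewrite lee_fin /f mulr_ge0 ?powR_ge0// exprn_ge0// powR_ge0.
  - exact/measurable_EFinP/measurable_funTS.
  - by apply: ge0_emeasurable_sum => [k z _ _|k _]; [exact: F0|exact: measurable_funTS].
rewrite integral_nneseries//; last by move=> k; exact: measurable_funTS.
apply: (@le_trans _ _ (\sum_(0 <= k <oo)
    ((N%:R * 2 * 4 ^+ N)%:E * A * (m k `^ (p - 1))%:E))%E).
  apply: lee_nneseries => [k _ _|k _]; last exact: FA.
  by apply: integral_ge0 => z _; exact: F0.
have Afin : A \is a fin_num.
  have := integral_grad_norm_powR_lty c1 ltr01.
  under eq_integral do rewrite powRr1 ?grad_norm_ge0//.
  by rewrite ge0_fin_numE.
rewrite -(fineK Afin) -EFinM nneseriesZl// => k _.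
by rewrite lee_fin powR_ge0.
Qed.

End dyadic.

(** * The norms of [u] and of its gradient *)

Section norms.
Context {R : realType} {N : nat}.
Implicit Types (u : 'rV[R]_N -> R).
Local Notation leb := (@lebesgue_rV R N).

(** The L^oo norm is defined as an essential supremum only on a space of positive measure. *)
Lemma lebesgue_rV_setT_gt0 : (0 < leb setT)%E.
Proof. by apply: (@lebesgue_rV_open_gt0 _ _ _ 0); first exact: openT. Qed.

Lemma LnormB_supE u : LnormB +oo u = ess_sup leb (fun x => `|(u \_ unit_ball) x|%:E).
Proof. by rewrite /LnormB unlock lebesgue_rV_setT_gt0. Qed.

(** If |u x| exceeded the essential supremum, then by continuity so would |u| on a neighbourhood of
    x, and nonempty open sets are not null. *)
Lemma C1_le_LnormB_sup u x : C1_closed_unit_ball u -> unit_ball x ->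
  (`|u x|%:E <= LnormB +oo u)%E.
Proof.
move=> c1 Bx; rewrite leNgt; apply/negP; rewrite LnormB_supE.
set e := ess_sup _ _ => ex.
have [m em mx] : exists2 m : R, (e <= m%:E)%E & m < `|u x|.
  have := Lnorm_ge0 leb +oo%E (EFin \o (u \_ unit_ball)).
  rewrite -[X in (0 <= X)%E]/(LnormB +oo u) LnormB_supE -/e.
  by case: e ex => [m| |]//; rewrite lte_fin => mx _; exists m.
have := ess_sup_ge leb (fun x => `|(u \_ unit_ball) x|%:E).
rewrite -/e => -[A [mA A0 eA]].
pose O := [set y | unit_ball y /\ m < `|u y|].
have oO : open O.
  rewrite openE => y [By my]; apply: (@filterI _ (nbhs y)).
    by apply: open_nbhs_nbhs; split => //; exact: open_unit_ball.
  have cy : {for y, continuous (fun z => `|u z|)}.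
    apply: (@continuous_comp _ _ _ u (fun r : R => `|r|)); first exact: C1_continuous.
    exact: norm_continuous.
  apply: (cy [set r | m < r]); apply: open_nbhs_nbhs; split => //.
have OA : O `<=` A.
  move=> y [By my]; apply: eA => /=; apply/negP; rewrite -ltNge.
  by rewrite (le_lt_trans em)// patchE mem_set// lte_fin.
have : (leb O <= leb A)%E.
  by apply: le_measure; rewrite ?inE//; exact: open_measurable_rV.
by rewrite A0 leNgt (@lebesgue_rV_open_gt0 _ _ _ x).
Qed.

Lemma LnormB_sup_fin u : C1_closed_unit_ball u -> LnormB +oo u \is a fin_num.
Proof.
move=> c1; have [L [L0 uL _]] := C1_bounded c1.
rewrite ge0_fin_numE; last exact: Lnorm_ge0.
apply: (@le_lt_trans _ _ L%:E); last exact: ltry.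
rewrite LnormB_supE; apply: (@ess_sup_ler _ _ _ _ (fun x => `|(u \_ unit_ball) x|)) => x.
by rewrite lee_fin.
Qed.

Lemma restrict_grad_normE u :
  abse \o (EFin \o ((enorm \o grad u) \_ unit_ball)) = EFin \o grad_norm u.
Proof.
apply/funext => x /=; rewrite ger0_norm//.
exact: (grad_norm_ge0 u x).
Qed.

Lemma LnormB1_gradE u :
  LnormB 1 (enorm \o grad u) = (\int[leb]_x (grad_norm u x)%:E)%E.
Proof.
rewrite /LnormB Lnorm1; apply: eq_integral => x _.
exact: (congr1 (fun f => f x) (restrict_grad_normE u)).
Qed.

Lemma LnormB_grad_powR u (q : R) : q != 0 ->
  (LnormB q%:E (enorm \o grad u) `^ q = \int[leb]_x (grad_norm u x `^ q)%:E)%E.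
Proof.
move=> q0; rewrite /LnormB poweR_Lnorm//; apply: eq_integral => x _.
rewrite -poweR_EFin; congr (_ `^ _)%E.
exact: (congr1 (fun f => f x) (restrict_grad_normE u)).
Qed.

Lemma LnormB_grad_sup u :
  LnormB +oo (enorm \o grad u) = ess_sup leb (EFin \o grad_norm u).
Proof. by rewrite /LnormB unlock lebesgue_rV_setT_gt0 restrict_grad_normE. Qed.

Lemma LnormB_grad_fin u (q : \bar R) : C1_closed_unit_ball u -> (0 < q)%E ->
  LnormB q (enorm \o grad u) \is a fin_num.
Proof.
move=> c1; rewrite ge0_fin_numE; last exact: Lnorm_ge0.
case: q => [q| |]//; last first.
  move=> _; have [L [L0 _ gL]] := C1_bounded c1.
  apply: (@le_lt_trans _ _ L%:E); last exact: ltry.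
  by rewrite LnormB_grad_sup; apply: ess_sup_ler => x; rewrite lee_fin.
rewrite lte_fin => q0.
have := integral_grad_norm_powR_lty c1 q0.
rewrite -LnormB_grad_powR ?gt_eqF// => h.
rewrite ltNge leye_eq; apply/negP => /eqP Loo.
by move: h; rewrite Loo poweRyr ?gt_eqF// ltxx.
Qed.

(** Reduces q = +oo to a finite exponent above N, for which Morrey's inequality is stated: on a set
    of finite measure an L^oo bound controls every power integral. *)
Lemma finite_exponent (q : \bar R) : (1 <= N)%N -> (N%:R%:E < q)%E ->
  exists q0 c : R, [/\ N%:R < q0, 0 < c & forall u (b : R),
    C1_closed_unit_ball u -> 0 < b ->
    (LnormB q (enorm \o grad u) <= b%:E)%E ->
    (\int[leb]_x (grad_norm u x `^ q0)%:E <= ((c * b) `^ q0)%:E)%E].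
Proof.
move=> hN; case: q => [q| |]//.
  rewrite lte_fin => Nq; exists q, 1; split => // u b c1 b0 gb.
  have q0 : 0 < q by rewrite (le_lt_trans _ Nq).
  rewrite mul1r -LnormB_grad_powR ?gt_eqF// -poweR_EFin.
  apply: gt0_ler_poweR; rewrite ?(ltW q0)// in_itv/= leey andbT.
    exact: Lnorm_ge0.
  by rewrite lee_fin ltW.
(* Adding 1 to the volume V makes the constant at least 1, whence V <= (V + 1)^(N+1). *)
move=> _; exists N.+1%:R, (@ball_volume R N + 1).
have V0 := @ball_volume_gt0 R N.
split; [by rewrite ltr_nat|by rewrite addr_gt0|].
move=> u b c1 b0; rewrite LnormB_grad_sup => /ess_supP gb.
have mB := @measurable_unit_ball R N.
apply: (@le_trans _ _ (\int[leb]_(x in unit_ball) (b `^ N.+1%:R)%:E)%E).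
  rewrite [leRHS]integral_mkcond; apply: ae_ge0_le_integral => //.
  - by move=> x _; rewrite lee_fin powR_ge0.
  - apply/measurable_EFinP.
    by apply: (measurableT_comp (measurable_powR _)); exact: measurable_grad_norm.
  - by move=> x _; rewrite patchE; case: ifP => // _; rewrite lee_fin powR_ge0.
  - by apply/(measurable_restrictT _ mB).
  case: gb => A [mA A0 hA]; exists A; split => // x hx; apply: hA => /= gx.
  apply: hx => _; rewrite patchE; case: ifPn => [xB|xB].
    rewrite lee_fin ge0_ler_powR ?nnegrE ?grad_norm_ge0// ?ltW//.
  by rewrite /grad_norm patchE (negbTE xB) powR0// pnatr_eq0.
rewrite integral_cst// [X in (_ * X)%E]lebesgue_rV_unit_ballE -EFinM lee_fin.
rewrite powRM ?addr_ge0 ?(ltW V0) ?(ltW b0)// mulrC ler_wpM2r ?powR_ge0//.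
apply: (@le_trans _ _ (@ball_volume R N + 1)); first by rewrite lerDl.
by rewrite le1r_powR ?ler1n// lerDr ltW.
Qed.

End norms.

(** * The cut-off index and the geometric tail *)

Section geometric.
Context {R : realType}.
Implicit Types t D : R.

(** The source of the logarithm: D t^n <= 1 as soon as n >= ln D / (- ln t), and rounding up costs
    at most 1. *)
Lemma geometric_threshold t D : 0 < t < 1 -> 1 <= D ->
  exists n : nat, D * t ^+ n <= 1 /\ n%:R <= ln D / (- ln t) + 1.
Proof.
move=> /andP[t0 t1] D1.
have lt0 : 0 < - ln t by rewrite oppr_gt0 ln_lt0// t0.
have D0 : 0 < D by exact: lt_le_trans D1.
have lD0 : 0 <= ln D by rewrite ln_ge0.
have r0 : 0 <= ln D / - ln t by rewrite divr_ge0// ltW.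
exists (Num.truncn (ln D / - ln t)).+1; split.
  rewrite -[leLHS]lnK ?posrE ?mulr_gt0 ?exprn_gt0// -expR0 ler_expR.
  rewrite lnM ?posrE ?exprn_gt0// lnXn// -mulr_natl.
  have := ltW (truncnS_gt (ln D / - ln t)).
  by rewrite ler_pdivrMr// mulrN; lra.
by rewrite -natr1 lerD2r; have /andP[] := truncn_itv r0.
Qed.

Lemma sum_truncated_geometric_le t n m : 0 < t < 1 ->
  \sum_(0 <= k < m) (if (k < n)%N then 1 else t ^+ (k - n)) <= n%:R + (1 - t)^-1.
Proof.
move=> /andP[t0 t1].
have t10 : 0 < 1 - t by rewrite subr_gt0.
(* The right-hand side is the exact value of the partial sum, which makes the induction go
   through. *)
suff : \sum_(0 <= k < m) (if (k < n)%N then 1 else t ^+ (k - n)) <=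
    (minn m n)%:R + (1 - t ^+ (m - n)) * (1 - t)^-1.
  move=> /le_trans; apply; apply: lerD; first by rewrite ler_nat geq_minr.
  by rewrite ler_piMl ?invr_ge0 ?(ltW t10)// gerBl exprn_ge0// ltW.
elim: m => [|m IH].
  by rewrite big_geq// min0n sub0n expr0 subrr mul0r addr0.
rewrite big_nat_recr//=; have [mn|nm] := ltnP m n.
  move: IH; rewrite (minn_idPl (ltnW mn)) (minn_idPl mn).
  rewrite (eqP (ltnW mn)) (eqP mn) expr0 subrr mul0r !addr0 => IH.
  by rewrite -natr1 lerD2r.
move: IH; rewrite (minn_idPr nm) (minn_idPr (leqW nm)) subSn// => IH.
apply: (le_trans (lerD IH (lexx _))); rewrite -addrA lerD2l exprS le_eqVlt.
by apply/orP; left; apply/eqP; field; rewrite gt_eqF.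
Qed.

End geometric.

(** * Choice of the constants and conclusion *)

Theorem theorem6 (R : realType) (N : nat) (p : R) (q : \bar R)
    (hN : (1 <= N)%N) (hp : 1 < p) (hq : (N%:R%:E < q)%E) :
  exists C : R, forall u : 'rV[R]_N -> R, C1_closed_unit_ball u ->
    (\int[lebesgue_rV N \x lebesgue_rV N]_(z in unit_ball `*` unit_ball)
        (`|u z.1 - u z.2| `^ p / enorm (z.1 - z.2) ^+ N.+1)%:E
     <= C%:E * LnormB +oo u `^ (p - 1) * LnormB 1 (enorm \o grad u)
        * (1 + lne (maxe (LnormB q (enorm \o grad u) / LnormB +oo u) 1)))%E.
Proof.
have [q0 [c [Nq0 c0 hc]]] := @finite_exponent R N q hN hq.
have [K K0 hK] := @morrey R N q0 hN Nq0.
have q0gt0 : 0 < q0 by rewrite (le_lt_trans _ Nq0).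
pose s := p - 1; have s0 : 0 < s by rewrite subr_gt0.
pose a := 1 - N%:R / q0.
have a0 : 0 < a by rewrite subr_gt0 ltr_pdivrMr// mul1r.
have a1 : a <= 1 by rewrite gerBl divr_ge0// ltW.
(* The ratio of Morrey's bounds on consecutive shells; [tau] below is the same ratio after taking
   (p-1)-st powers. *)
pose t : R := 2 `^ (- a).
have t01 : 0 < t < 1.
  rewrite powR_gt0//= /t powRN invf_lt1 ?powR_gt0//.
  rewrite [ltLHS](_ : 1 = 1 `^ a); last by rewrite powR1.
  by apply: gt0_ltr_powR; rewrite ?nnegrE ?ltr1n.
have [t0 t1] := andP t01.
pose tau := t `^ s.
have tau01 : 0 < tau < 1.
  rewrite powR_gt0//= [ltRHS](_ : 1 = 1 `^ s); last by rewrite powR1.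
  by apply: gt0_ltr_powR; rewrite ?nnegrE ?(ltW t0).
have [tau0 tau1] := andP tau01.
(* The first 2 serves the trivial bound 2 ||u||_oo; 2 K c serves Morrey's, with 2^a <= 2. *)
pose K2 := 2 + 2 * K * c.
have K20 : 0 <= K2 by rewrite addr_ge0// !mulr_ge0// ltW.
have lt0 : 0 < - ln t by rewrite oppr_gt0 ln_lt0.
have g0 : 0 <= (1 - tau)^-1 by rewrite invr_ge0 subr_ge0 ltW.
(* Chosen so that n + 1/(1 - tau) <= C1 (1 + ln D) whenever n <= ln D / (- ln t) + 1. *)
pose C1 := 1 + (- ln t)^-1 + (1 - tau)^-1.
exists (N%:R * 2 * 4 ^+ N * K2 `^ s * C1) => u c1.
have := LnormB_sup_fin c1.
have := fun x => @C1_le_LnormB_sup R N u x c1.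
have : (0 <= LnormB +oo u)%E by exact: Lnorm_ge0.
case: (LnormB +oo u) => // m; rewrite lee_fin => m0 um _.
have {}um x : unit_ball x -> `|u x| <= m by move=> /um; rewrite lee_fin.
(* If m = 0, then [u] vanishes on the ball, and the factor m^(p-1) = 0 annihilates the right-hand
   side whatever value the quotient takes. *)
move: m0; rewrite le_eqVlt => /predU1P[m0|m0].
  rewrite integral0_eq; last first.
    move=> z [/um + /um]; rewrite -m0 !normr_le0 => /eqP -> /eqP ->.
    by rewrite subrr normr0 powR0 ?mul0r// gt_eqF// (lt_trans ltr01).
  by rewrite -m0 poweR_EFin powR0 ?gt_eqF// mule0 !mul0e.
have := LnormB_grad_fin c1 (ltr01 : (0 < 1%:E)%E).
rewrite LnormB1_gradE.
have qgt0 : (0 < q)%E by apply: le_lt_trans hq; rewrite lee_fin.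
have := LnormB_grad_fin c1 qgt0.
have := hc u _ c1.
have : (0 <= LnormB q (enorm \o grad u))%E by exact: Lnorm_ge0.
case: (LnormB q _) => // b0; rewrite lee_fin => b00 hb _ Afin.
(* With b = m D = max(b0, m), Morrey's inequality receives a positive bound even when the gradient
   vanishes. *)
pose D := Num.max (b0 / m) 1.
have D1 : 1 <= D by rewrite le_max lexx orbT.
have D0 : 0 < D by exact: lt_le_trans D1.
pose b := m * D.
have bgt0 : 0 < b by rewrite mulr_gt0.
have b0b : b0 <= b by rewrite /b mulrC -ler_pdivrMr// le_max lexx.
have cb0 : 0 < c * b by rewrite mulr_gt0.
have {}hK := hK u _ c1 cb0 (hb b bgt0 (b0b : (b0%:E <= b%:E)%E)).
have [n [Dn nD]] := geometric_threshold t01 D1.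
pose e k := if (k < n)%N then 1 else t ^+ (k - n).
have e0 k : 0 <= e k by rewrite /e; case: ifP => // _; rewrite exprn_ge0// ltW.
(* Constant on the first n shells, then decaying with ratio t from the shell where Morrey's bound
   has come down to the order of m. *)
pose mk k := m * K2 * e k.
have scaleE k : (2 * 2^-1 ^+ k) `^ a = 2 `^ a * t ^+ k.
  rewrite powRM ?exprn_ge0 ?invr_ge0//; congr (_ * _).
  rewrite -(@powR_mulrn _ 2^-1 k) ?invr_ge0// powRAC powR_mulrn ?powR_ge0//.
  by rewrite -[2^-1]powR_inv1// -powRrM mulN1r.
have umk k x y : unit_ball x -> unit_ball y ->
    enorm (x - y) < 2 * 2^-1 ^+ k -> `|u x - u y| <= mk k.
  move=> Bx By xyk; rewrite /mk /e; case: ltnP => kn.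
    rewrite mulr1; apply: (@le_trans _ _ (m + m)).
      by apply: (le_trans (ler_normB _ _)); rewrite lerD// um.
    by rewrite -mulr2n -mulr_natr ler_wpM2l ?(ltW m0)// lerDl !mulr_ge0// ltW.
  apply: (le_trans (hK x y Bx By)); rewrite -/a.
  apply: (@le_trans _ _ (K * (c * b) * (2 `^ a * t ^+ k))).
    apply: ler_wpM2l; first by rewrite mulr_ge0// ltW.
    rewrite -scaleE; apply: ge0_ler_powR;
      by rewrite ?nnegrE ?enorm_ge0 ?(ltW a0) ?(ltW xyk).
  have a2 : 2 `^ a <= 2 :> R by rewrite -[leRHS]powRr1// ler_powR// ler1n.
  (* Of the decay t^k, the part t^n is spent on absorbing D; only t^(k-n) remains. *)
  rewrite -{1}(subnK kn) exprD /b.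
  have -> : K * (c * (m * D)) * (2 `^ a * (t ^+ (k - n) * t ^+ n)) =
     m * (K * c * (2 `^ a * (D * t ^+ n))) * t ^+ (k - n) by ring.
  rewrite ler_wpM2r ?exprn_ge0 ?(ltW t0)// ler_wpM2l ?(ltW m0)//.
  rewrite /K2; apply: (@le_trans _ _ (K * c * 2)); last by lra.
  rewrite ler_wpM2l ?mulr_ge0 ?(ltW c0)//.
  rewrite (le_trans (ler_wpM2l _ Dn)) ?powR_ge0// mulr1.
  exact: a2.
apply: (le_trans (gagliardo_integral_le c1 hp umk)).
set A := (\int[_]_x (grad_norm u x)%:E)%E in Afin *.
have A0 : (0 <= A)%E by apply: integral_ge0 => x _; rewrite lee_fin grad_norm_ge0.
rewrite poweR_EFin -/s inver gt_eqF//.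
have -> : (maxe (b0%:E * (m^-1)%:E) 1 = D%:E)%E by rewrite -EFinM -EFin_max.
rewrite lne_EFin//.
have sumE k : mk k `^ s = m `^ s * K2 `^ s * (if (k < n)%N then 1 else tau ^+ (k - n)).
  rewrite /mk !powRM ?mulr_ge0 ?(ltW m0)//; congr (_ * _); rewrite /e.
  case: ifP => _; first by rewrite powR1.
  by rewrite -(@powR_mulrn _ t) ?(ltW t0)// powRAC powR_mulrn ?powR_ge0.
have sum_le : (\sum_(0 <= k <oo) (mk k `^ s)%:E <=
    (m `^ s * K2 `^ s * (C1 * (1 + ln D)))%:E)%E.
  apply: lime_le; first by apply: is_cvg_nneseries => k _ _; rewrite lee_fin powR_ge0.
  apply: nearW => j; rewrite sumEFin lee_fin.
  under eq_bigr do rewrite sumE.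
  rewrite -mulr_sumr ler_wpM2l ?mulr_ge0 ?powR_ge0//.
  apply: (le_trans (sum_truncated_geometric_le n j tau01)).
  have lD : 0 <= ln D by rewrite ln_ge0.
  have : 0 <= ln D * (1 - tau)^-1 by rewrite mulr_ge0.
  have : 0 <= (- ln t)^-1 by rewrite invr_ge0 ltW.
  by rewrite /C1; move: nD; lra.
apply: (le_trans (lee_wpmul2l _ sum_le)).
  by rewrite mule_ge0// lee_fin !mulr_ge0// exprn_ge0.
have -> : (1 + (ln D)%:E = (1 + ln D)%:E)%E by rewrite EFinD.
rewrite -(fineK Afin) -!EFinM lee_fin le_eqVlt.
by apply/orP; left; apply/eqP; ring.
Qed.
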